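(* Let $s$, $k$, $q$ be integers, $s\geq 1$, satisfying $qk \leq s$ and $(q-k)^2 \leq s-k$. Then $\widehat{\alpha}(s) \geq q$, where $\widehat{\alpha}(s)$ denotes the Waldschmidt constant of the ideal of $s$ very general lines in $\mathbb{P}^3$.
   Context: Let $\mathbb{K}$ be an uncountable algebraically closed field of characteristic $0$ and $R=\mathbb{K}[x_0,\dots,x_3]$. For a homogeneous ideal $I\subset R$, the $m$-th symbolic power is $I^{(m)}=R\cap\bigcap_{P\in\mathrm{Ass}(I)}I^mR_P$ (intersection taken in the fraction field of $R$). The initial degree of a nonzero homogeneous ideal $I$ is $\alpha(I)=\min\{t: (I)_t\neq 0\}$, where $(I)_t$ is the degree $t$ part of $I$. The Waldschmidt constant of $I$ is $\widehat{\alpha}(I)=\lim_{m\to\infty}\alpha(I^{(m)})/m$ (the limit exists). ''Very general'' means: outside a countable union of proper Zariski closed subsets of the parameter space (here the product of $s$ copies of the Grassmannian of lines in $\mathbb{P}^3$). For an integer $s\ge 1$, $\widehat{\alpha}(s)$ denotes the Waldschmidt constant of the radical ideal of the union of $s$ very general lines in $\mathbb{P}^3$. *)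

(* Defs.v *)
From mathcomp Require Import all_boot all_order all_algebra.
(* [mpoly] has to be imported before the analysis files: their notations clash
   in the other order. *)
From mathcomp Require Import mpoly.
From mathcomp Require Import boolp classical_sets cardinality reals.
From mathcomp Require Import topology normedtype sequences.

Set Implicit Arguments.
Unset Strict Implicit.
Unset Printing Implicit Defensive.

Import Order.TTheory GRing.Theory Num.Theory numFieldNormedType.Exports.

Local Open Scope classical_set_scope.
Local Open Scope ring_scope.

Section SymbolicPowers.
Variable S : idomainType.
Implicit Types I J P : set S.

(* [idealr_closed] includes 1 \notin P. *)
Definition prime_ideal P : Prop :=
  idealr_closed (mem P) /\ prime_idealr_closed (mem P).

(* Associated primes of S/I, i.e. the primes of the form (I : f). *)
Definition Ass I : set (set S) :=
  [set P | prime_ideal P /\ exists f : S, P = [set g | I (g * f)]].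

Definition ideal_exp I (m : nat) : set S :=
  [set f | exists (n : nat) (c : 'I_n -> S) (h : 'I_n -> 'I_m -> S),
     (forall i j, I (h i j)) /\ f = \sum_(i < n) c i * \prod_(j < m) h i j].

(* J S_P as a subset of the fraction field of S, for an ideal J and a prime
   ideal P: every element of J S_P is a single fraction a / g. *)
Definition loc_ext J P : set {fraction S} :=
  [set x | exists a g : S, [/\ J a, ~ P g & x = tofrac a / tofrac g]].

Definition symbolic_power I (m : nat) : set S :=
  @tofrac S @^-1` \bigcap_(P in Ass I) loc_ext (ideal_exp I m) P.

End SymbolicPowers.

Section Waldschmidt.
Variables (K : fieldType) (n : nat).
Implicit Types I : set {mpoly K[n]}.

Definition nonzero_degree_part I (t : nat) : Prop :=
  exists f : {mpoly K[n]}, [/\ I f, f != 0 & f \is t.-homog].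

(* The minimum over an empty set of degrees (I = 0) is 0 by convention. *)
Definition initial_degree I : nat :=
  xget 0%N [set t | nonzero_degree_part I t /\
                    forall u, nonzero_degree_part I u -> (t <= u)%N].

Definition waldschmidt (R : realType) I : R :=
  limn (fun m : nat => (initial_degree (symbolic_power I m))%:R / m%:R : R).

End Waldschmidt.

Section Lines.
Variable K : fieldType.

(* Lines of P^3 are 2-dimensional linear subspaces of K^4. *)
Definition line : Type := {U : {vspace 'rV[K]_4} | \dim U == 2}.

(* A line is identified with its cone in K^4; over an infinite field, the
   polynomials vanishing on the cone are those all of whose homogeneous
   components vanish on the line, so this is the radical homogeneous ideal of
   the union of the L a. *)
Definition lines_ideal (s : nat) (L : 'I_s -> line) : set {mpoly K[4]} :=
  [set f | forall (a : 'I_s) (v : 'rV[K]_4),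
     v \in val (L a) -> f.@[fun i => v 0 i] = 0].

(* Pluecker coordinates, as the full antisymmetric 4 x 4 array (a linear
   embedding of the usual P^5 of coordinates with i < j).  Another basis of
   the line rescales the array by a nonzero constant. *)
Definition plucker (U : line) (i j : 'I_4) : K :=
  let B := vbasis (val U) in
  B`_0 0 i * B`_1 0 j - B`_0 0 j * B`_1 0 i.

Definition plucker_index (s : nat) : finType := ('I_s * ('I_4 * 'I_4))%type.

Definition plucker_tuple (s : nat) (L : 'I_s -> line) :
    'I_#|plucker_index s| -> K :=
  fun k => let: (a, (i, j)) := enum_val k in plucker (L a) i j.

Definition multihomog (s : nat) (f : {mpoly K[#|plucker_index s|]}) : Prop :=
  exists d : 'I_s -> nat, forall m, m \in msupp f -> forall a : 'I_s,
    (\sum_(i < 4) \sum_(j < 4)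
       m (enum_rank ((a, (i, j)) : plucker_index s)))%N = d a.

(* Zariski closed subsets of the product of s copies of the Grassmannian,
   embedded by Pluecker coordinates in a product of projective spaces. *)
Definition zariski_closed (s : nat) (Z : set ('I_s -> line)) : Prop :=
  exists F : set {mpoly K[#|plucker_index s|]},
    (forall f, F f -> multihomog f) /\
    Z = [set L | forall f, F f -> f.@[plucker_tuple L] = 0].

Definition for_very_general_lines (s : nat) (Q : ('I_s -> line) -> Prop) :
    Prop :=
  exists Z : nat -> set ('I_s -> line),
    (forall n, zariski_closed (Z n) /\ Z n <> setT) /\
    (forall L, ~ (\bigcup_n Z n) L -> Q L).

End Lines.

(* Main.v *)
Require Import Defs.
From mathcomp Require Import all_boot all_order all_algebra.
From mathcomp Require Import mpoly.
From mathcomp Require Import boolp classical_sets cardinality reals.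
From mathcomp Require Import topology normedtype sequences.
From mathcomp Require Import ring lra zify.

(** Suppose that a form of degree [d] has multiplicity [m] along [s] lines and
    that [d < q m].  The bound is obtained from a chain of hyperplanes: if a
    linear space has [q] distinct hyperplanes on each of which the form
    vanishes, it is divisible by the product of their equations, which lowers
    [d] by [q] and [m] by at most one, so that [d < q m] persists and the form
    is zero by induction on [m].  In P^3 use [q] planes containing [k] of the
    lines each; in such a plane use these [k] lines and [t = q - k] further
    lines, each carrying [t] intersection points with lines outside the plane;
    a line of the second kind contains [k + t = q] points of multiplicity [m].

    The required collinearity of the [t^2] points can be arranged for each
    plane separately, but not explicitly for all planes at once.  Interpolating
    between the [q] configurations gives a one-parameter family of lines, the
    failure of the bound in one plane for one [m] is the vanishing of a nonzero
    polynomial in the parameter, and [K] is uncountable, so some member of the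
    family works for all planes and all [m].

    Finally, the lines for which a form of degree [d] and multiplicity [m]
    exists are cut out by the maximal minors of a linear system whose entries
    are polynomials in the Pluecker coordinates; by the special configuration
    this closed set is proper.  The limit defining the Waldschmidt constant
    exists by Fekete's lemma and is the infimum of the sequence. *)

Set Implicit Arguments.
Unset Strict Implicit.
Unset Printing Implicit Defensive.

Import Order.TTheory GRing.Theory Num.Theory numFieldNormedType.Exports.

Local Open Scope classical_set_scope.
Local Open Scope ring_scope.

(** * Multiplicity along a linear subspace *)

Lemma mmap_rmorph n (R : comNzRingType) (S S' : comNzRingType)
    (phi : {rmorphism S -> S'}) (iota : R -> S) (x : 'I_n -> S)
    (f : {mpoly R[n]}) :
  phi (mmap iota x f) = mmap (phi \o iota) (phi \o x) f.
Proof.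
rewrite /mmap rmorph_sum; apply: eq_bigr => m _.
rewrite rmorphM /mmap1 rmorph_prod; congr (_ * _).
by apply: eq_bigr => i _; rewrite rmorphXn.
Qed.

Lemma eq_mmap n (R : comNzRingType) (S : comNzRingType)
    (iota iota' : R -> S) (x x' : 'I_n -> S) (f : {mpoly R[n]}) :
  iota =1 iota' -> x =1 x' -> mmap iota x f = mmap iota' x' f.
Proof.
move=> ei ex; rewrite /mmap; apply: eq_bigr => m _; rewrite ei; congr (_ * _).
by apply: eq_bigr => i _; rewrite ex.
Qed.

(** Over a domain the lowest nonzero coefficients, at [a <= k] and [b <= i], multiply to the
    coefficient of [G * H] at [a + b], which lies below [m + r]. *)
Lemma coefM_vanish (D : idomainType) (G H : {poly D}) (m r k : nat) :
  (forall i, (i < m + r)%N -> (G * H)`_i = 0) -> (k <= r)%N -> G`_k != 0 ->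
  forall i, (i < m)%N -> H`_i = 0.
Proof.
move=> GH0 kr Gk i im; apply/eqP/negPn/negP => Hi.
have exG : exists j, G`_j != 0 by exists k.
have exH : exists j, H`_j != 0 by exists i.
case: (ex_minnP exG) => a Ga mina; case: (ex_minnP exH) => b Hb minb.
have ak : (a <= k)%N by apply: mina.
have bi : (b <= i)%N by apply: minb.
have : (G * H)`_(a + b) = 0 by apply: GH0; lia.
have ab : (a < (a + b).+1)%N by lia.
rewrite coefM (bigD1 (Ordinal ab)) //= big1 ?addr0.
  by rewrite addKn; move/eqP; rewrite mulf_eq0 (negPf Ga) (negPf Hb).
move=> j /eqP ja.
have [ltja|] := ltnP j a.
  by case: (eqVneq G`_j 0) => [->|/mina]; [rewrite mul0r | lia].
rewrite leq_eqVlt => /orP[/eqP eaj|ltaj].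
  by case: ja; apply: val_inj.
case: (eqVneq H`_(a + b - j) 0) => [->|/minb]; first by rewrite mulr0.
by have := ltn_ord j; lia.
Qed.

Section Multiplicity.
Variables (K : closedFieldType) (n : nat).
Implicit Types (f g F : {mpoly K[n]}) (p v x y : 'rV[K]_n) (U W : set 'rV[K]_n).

Lemma poly_ext (P Q : {poly K}) : (forall c, P.[c] = Q.[c]) -> P = Q.
Proof.
move=> PQ; apply/eqP; rewrite -subr_eq0; apply/negPn/negP.
case/closed_nonrootP => c; rewrite rootE !hornerE PQ subrr eqxx //.
Qed.

Definition ev f x : K := f.@[fun i => x 0 i].

Definition along f p v : {poly K} :=
  mmap polyC (fun i => (p 0 i)%:P + (v 0 i)%:P * 'X) f.

Lemma horner_along f p v c : (along f p v).[c] = ev f (p + c *: v).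
Proof.
rewrite /along -/(horner_eval c _) mmap_rmorph /ev /meval.
apply: eq_mmap => [a|i] /=; rewrite /horner_eval !hornerE //.
by rewrite !mxE mulrC.
Qed.

Lemma along_coef0 f p v : (along f p v)`_0 = ev f p.
Proof. by rewrite -horner_coef0 horner_along scale0r addr0. Qed.

Definition lin U := U 0 /\ forall c x y, U x -> U y -> U (c *: x + y).

(* [T ^ m] divides [f (p + T v)] for [p] in [W] and every direction [v] of
   [U], i.e. the restriction of [f] to [U] has order at least [m] along
   [W `&` U]. *)
Definition ord U W (m : nat) f :=
  forall p v, U p -> W p -> U v -> forall i, (i < m)%N -> (along f p v)`_i = 0.

Lemma ord_leq U W m m' f : (m' <= m)%N -> ord U W m f -> ord U W m' f.
Proof. by move=> mm o p v Up Wp Uv i im; apply: o => //; lia. Qed.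

Lemma ord_subset U W W' m f : U `&` W' `<=` W -> ord U W m f -> ord U W' m f.
Proof. by move=> sub o p v Up Wp Uv; apply: o => //; apply: sub. Qed.

Lemma ord_one U W f :
  ord U W 1 f <-> (forall x, U x -> W x -> ev f x = 0).
Proof.
split=> [o x Ux Wx|f0 p v Up Wp Uv [|//] _]; last by rewrite along_coef0 f0.
by rewrite -(along_coef0 f x x) o.
Qed.

Lemma lin_pencil U : lin U ->
  forall x y c, U x -> U y -> U (x + c *: (y - x)).
Proof.
move=> [U0 UL] x y c Ux Uy.
have -> : x + c *: (y - x) = c *: y + ((- c) *: x + x).
  by apply/rowP => i; rewrite !mxE; ring.
by apply: (UL) => //; apply: (UL).
Qed.

(** The inner variable moves the pair (point, direction) from [(p, v)] at 0 to [(p1, v1)] at 1; the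
    outer one is the variable of [along]. *)
Definition pencil f p p1 v v1 : {poly {poly K}} :=
  mmap (polyC \o polyC)
    (fun i => ((p 0 i)%:P + ((p1 - p) 0 i)%:P * 'X)%:P +
              ((v 0 i)%:P + ((v1 - v) 0 i)%:P * 'X)%:P * 'X) f.

Lemma pencil_coef f p p1 v v1 i c :
  ((pencil f p p1 v v1)`_i).[c] =
  (along f (p + c *: (p1 - p)) (v + c *: (v1 - v)))`_i.
Proof.
rewrite -/(horner_eval c _) -coef_map /pencil mmap_rmorph /along.
congr (nth 0 (polyseq _) i); apply: eq_mmap => [a|j] /=.
  by rewrite map_polyC /= /horner_eval hornerC.
rewrite rmorphD rmorphM /= map_polyX !map_polyC /= /horner_eval !hornerE.
by rewrite !mxE ![_ * c]mulrC.
Qed.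

(* The pencil joins an arbitrary pair (point, direction) to one at which the
   order of [g] is at most [r]; over the domain [K[u]] orders add up. *)
Lemma ord_quotient U W F g f m r k p1 v1 : lin U -> lin W ->
  (forall x, U x -> ev F x = ev g x * ev f x) ->
  ord U W (m + r) F -> U p1 -> W p1 -> U v1 -> (k <= r)%N ->
  (along g p1 v1)`_k != 0 -> ord U W m f.
Proof.
move=> lU lW Fgf oF Up1 Wp1 Uv1 kr gk p v Up Wp Uv i im.
have alongM a b : U a -> U b -> along F a b = along g a b * along f a b.
  move=> Ua Ub; apply: poly_ext => c; rewrite hornerM !horner_along Fgf //.
  by rewrite addrC; apply: lU.2.
have pM : pencil F p p1 v v1 = pencil g p p1 v v1 * pencil f p p1 v v1.
  apply/polyP => j; apply: poly_ext => c; rewrite pencil_coef alongM.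
  - rewrite !coefM horner_sum; apply: eq_bigr => l _.
    by rewrite hornerM !pencil_coef.
  - exact: lin_pencil.
  - exact: lin_pencil.
have p0 : forall j, (j < m + r)%N ->
    (pencil g p p1 v v1 * pencil f p p1 v v1)`_j = 0.
  move=> j jm; rewrite -pM; apply: poly_ext => c; rewrite pencil_coef horner0.
  by apply: oF => //; exact: lin_pencil.
(* The value 1 of the inner variable recovers [(p1, v1)], so this coefficient is a nonzero
   polynomial; the value 0 recovers [(p, v)] at the end. *)
have gk' : (pencil g p p1 v v1)`_k != 0.
  apply: contraNneq gk => g0.
  have := pencil_coef g p p1 v v1 k 1; rewrite g0 horner0 !scale1r.
  by rewrite ![_ + (_ - _)]addrC !subrK => <-.
have /(_ i im) f0 := coefM_vanish p0 kr gk'.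
have := pencil_coef f p p1 v v1 i 0.
by rewrite f0 horner0 !scale0r !addr0.
Qed.

End Multiplicity.

(** * Division by linear forms *)

Section LinearForms.
Variables (K : closedFieldType) (n : nat).
Implicit Types (f g : {mpoly K[n]}) (p v x y : 'rV[K]_n) (h : 'cV[K]_n).
Implicit Types (U W : set 'rV[K]_n) (hs : seq 'cV[K]_n).

Definition lf h x : K := (x *m h) 0 0.

Lemma lfE h x : lf h x = \sum_i x 0 i * h i 0.
Proof. by rewrite /lf !mxE. Qed.

Lemma lf0 h : lf h 0 = 0.
Proof. by rewrite /lf mul0mx mxE. Qed.

Lemma lfP h c x y : lf h (c *: x + y) = c * lf h x + lf h y.
Proof. by rewrite /lf mulmxDl -scalemxAl !mxE. Qed.

Lemma lfZ h c x : lf h (c *: x) = c * lf h x.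
Proof. by rewrite /lf -scalemxAl !mxE. Qed.

Lemma lfB h x y : lf h (x - y) = lf h x - lf h y.
Proof. by rewrite -scaleN1r addrC lfP mulN1r addrC. Qed.

Definition hker h : set 'rV[K]_n := [set x | lf h x = 0].

Lemma lin_hker h : lin (hker h).
Proof.
by split=> [|c x y]; rewrite /hker /= ?lf0 // lfP => -> ->; rewrite mulr0 addr0.
Qed.

Lemma linI U W : lin U -> lin W -> lin (U `&` W).
Proof.
move=> [U0 UL] [W0 WL]; split=> // c x y [Ux Wx] [Uy Wy].
by split; [apply: UL | apply: WL].
Qed.

Lemma linZ U c x : lin U -> U x -> U (c *: x).
Proof. by move=> [U0 UL] Ux; rewrite -[_ *: _]addr0; apply: UL. Qed.

Lemma linB U x y : lin U -> U x -> U y -> U (x - y).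
Proof. by move=> [U0 UL] Ux Uy; rewrite addrC -scaleN1r; apply: UL. Qed.

Lemma evM f g x : ev (f * g) x = ev f x * ev g x.
Proof. exact: mevalM. Qed.

Lemma evD f g x : ev (f + g) x = ev f x + ev g x.
Proof. exact: mevalD. Qed.

Lemma evZ c f x : ev (c *: f) x = c * ev f x.
Proof. exact: mevalZ. Qed.

Lemma ev_sum (I : Type) (r : seq I) (F : I -> {mpoly K[n]}) x :
  ev (\sum_(i <- r) F i) x = \sum_(i <- r) ev (F i) x.
Proof. exact: raddf_sum. Qed.

Definition lform h : {mpoly K[n]} := \sum_i h i 0 *: 'X_i.

Lemma ev_lform h x : ev (lform h) x = lf h x.
Proof.
rewrite /lform ev_sum lfE; apply: eq_bigr => i _.
by rewrite evZ /ev mevalXU mulrC.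
Qed.

Lemma msize_lform h : (msize (lform h) <= 2)%N.
Proof.
apply: leq_trans (msize_sum _ _ _) _; apply/bigmax_leqP => i _.
by apply: leq_trans (msizeZ_le _ _) _; rewrite msizeX mdeg1.
Qed.

Lemma along_lform h p v : along (lform h) p v = (lf h p)%:P + (lf h v)%:P * 'X.
Proof.
apply: poly_ext => c; rewrite horner_along ev_lform !hornerE addrC lfP.
by rewrite addrC mulrC.
Qed.

Lemma msizeM_leq f g d e :
  (msize f <= d.+1)%N -> (msize g <= e)%N -> (msize (f * g) <= d + e)%N.
Proof.
move=> sf sg; have [->|f0] := eqVneq f 0; first by rewrite mul0r msize0.
have [->|g0] := eqVneq g 0; first by rewrite mulr0 msize0.
by rewrite msizeM // -subn1 leq_subLR addnA leq_add // add1n.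
Qed.

(** Induction on the degree, splitting off one variable: the shift changes each coordinate by a
    multiple of [lf h x]. *)
Lemma monomial_quotient h v0 (m : 'X_{1..n}) :
  exists2 g : {mpoly K[n]}, (msize g <= mdeg m)%N &
    forall x, ev 'X_[m] x - ev 'X_[m] (x - lf h x *: v0) = lf h x * ev g x.
Proof.
elim: {m}(mdeg m) {-2}m (erefl (mdeg m)) => [|d IH] m.
  move/eqP; rewrite mdeg_eq0 => /eqP ->; exists 0; first by rewrite msize0.
  by move=> x; rewrite /ev mpolyX0 !meval1 meval0 mulr0 subrr.
move=> md; have [i mi] : exists i, m i != 0%N.
  apply/existsP; rewrite -[X in is_true X]negbK negb_exists.
  apply/negP => /forallP m0; move: md; rewrite mdegE big1 // => i _.
  by apply/eqP/negPn/m0.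
have em : m = (U_(i) + (m - U_(i)))%MM by rewrite addmC submK ?lep1mP.
have md' : mdeg (m - U_(i)) = d.
  by move: md; rewrite {1}em mdegD mdeg1 add1n => -[].
have [g szg Hg] := IH _ md'; rewrite em mdegD mdeg1 md'.
(* With x' the shifted point and M the remaining monomial, x_i M(x) - x'_i M(x') = (x_i - x'_i) M(x)
   + x'_i (M(x) - M(x')). *)
exists (v0 0 i *: 'X_[m - U_(i)] + ('X_i - v0 0 i *: lform h) * g).
  apply: leq_trans (msizeD_le _ _) _; rewrite geq_max; apply/andP; split.
    by apply: leq_trans (msizeZ_le _ _) _; rewrite msizeX md' add1n.
  apply: msizeM_leq; last by rewrite -md'.
  apply: leq_trans (msizeD_le _ _) _; rewrite geq_max msizeX mdeg1 /= msizeN.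
  by apply: leq_trans (msizeZ_le _ _) (msize_lform _).
move=> x; rewrite mpolyXD !evM evD evM.
have -> : ev 'X_[m - U_(i)] x =
    ev 'X_[m - U_(i)] (x - lf h x *: v0) + lf h x * ev g x.
  by rewrite -Hg addrC subrK.
rewrite /ev !mevalB !mevalZ !mevalXU -!/(ev _ _) ev_lform !mxE.
have -> : ev 'X_[m - U_(i)] (x - lf h x *: v0) =
    ev 'X_[m - U_(i)] x - lf h x * ev g x by rewrite -Hg opprB [RHS]addrC subrK.
ring.
Qed.

(* Along a vector with [lf h v0 = 1] the projection [x - lf h x *: v0] maps
   into the hyperplane, where [f] vanishes. *)
Lemma factor_form U h f : lin U -> (exists2 x, U x & lf h x != 0) ->
  (forall x, U x -> lf h x = 0 -> ev f x = 0) ->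
  exists2 g, (msize g <= (msize f).-1)%N &
    forall x, U x -> ev f x = lf h x * ev g x.
Proof.
move=> lU [x0 Ux0 hx0] f0; pose v0 := (lf h x0)^-1 *: x0.
have Uv0 : U v0 by apply: linZ.
have hv0 : lf h v0 = 1 by rewrite lfZ mulVf.
have /choice [g Hg] : forall m : 'X_{1..n}, exists g : {mpoly K[n]},
    (msize g <= mdeg m)%N /\
    forall x, ev 'X_[m] x - ev 'X_[m] (x - lf h x *: v0) = lf h x * ev g x.
  by move=> m; have [g] := monomial_quotient h v0 m; exists g.
exists (\sum_(m <- msupp f) f@_m *: g m).
  apply: leq_trans (msize_sum _ _ _) _; apply/bigmax_leqP_seq => m mf _.
  apply: leq_trans (msizeZ_le _ _) _; apply: leq_trans (Hg m).1 _.
  by have := msize_mdeg_lt mf; lia.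
move=> x Ux; have : ev f (x - lf h x *: v0) = 0.
  apply: f0; first by apply: linB => //; apply: linZ.
  by rewrite lfB lfZ hv0 mulr1 subrr.
move=> fx0; rewrite -[LHS]subr0 -fx0 {1 2}(mpolyE f) !ev_sum.
rewrite -sumrB mulr_sumr; apply: eq_bigr => m _.
by rewrite !evZ -mulrBr (Hg m).2 mulrCA.
Qed.

(** The forms are divided out one at a time. The quotient still vanishes on the remaining
    hyperplanes, since inside [U] none of them lies in the removed one; order along [W] is lost only
    to forms vanishing on all of [W] inside [U]. *)
Lemma peel U hs f : lin U -> uniq hs ->
  (forall h h', h \in hs -> h' \in hs -> h <> h' ->
     exists x, [/\ U x, lf h x = 0 & lf h' x != 0]) ->
  (forall h, h \in hs -> forall x, U x -> lf h x = 0 -> ev f x = 0) ->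
  (exists2 x, U x & ev f x != 0) ->
  exists g, [/\ exists2 x, U x & ev g x != 0, (msize g + size hs <= msize f)%N
    & forall W m, lin W ->
        ord U W (m + count (fun h => `[< U `&` W `<=` hker h >]) hs) f ->
        ord U W m g].
Proof.
move=> lU; elim: hs f => [|h hs IH] f /=.
  move=> _ _ _ fn0; exists f; split=> //; first by rewrite addn0.
  by move=> W m _; rewrite addn0.
move=> /andP[hhs uhs] hdist f0 [x0 Ux0 fx0].
have f0h x : U x -> lf h x = 0 -> ev f x = 0 by apply: f0; rewrite mem_head.
have hx0 : lf h x0 != 0 by apply: contraNneq fx0 => /(f0h _ Ux0) ->.
have h_n0 : exists2 x, U x & lf h x != 0 by exists x0.
have [g szg fg] := factor_form lU h_n0 f0h.
have gx0 : ev g x0 != 0.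
  by apply: contraNneq fx0 => gx0; rewrite fg // gx0 mulr0.
have g_pos : (0 < msize g)%N.
  rewrite lt0n msize_poly_eq0; apply: contraNneq gx0 => ->.
  by rewrite /ev meval0.
have fg' x : U x -> ev f x = ev (lform h) x * ev g x.
  by move=> Ux; rewrite ev_lform fg.
have g_n0 : exists2 x, U x & ev g x != 0 by exists x0.
have [||g' [g'n0 szg' og']] // := IH g uhs _ _ g_n0.
- by move=> h1 h2 h1s h2s; apply: hdist; rewrite inE (h1s, h2s) orbT.
- move=> h' h's x Ux h'x0.
  have h'h : h' <> h by move=> e; move: hhs; rewrite -e h's.
  have [||y [Uy h'y hy]] := hdist h' h _ _ h'h; rewrite ?mem_head //.
    by rewrite inE h's orbT.
  apply: ((ord_one U (hker h') g).1 _ x Ux h'x0).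
  apply: (ord_quotient (r := 0) (k := 0) (p1 := y) (v1 := y) lU _ fg') => //.
  + exact: lin_hker.
  + by apply/ord_one => z Uz h'z; apply: (f0 h') => //; rewrite inE h's orbT.
  + by rewrite along_coef0 ev_lform.
exists g'; split=> //; first by lia.
move=> W m lW; case: asboolP => /= [hW|nhW] of_; apply: og' => //.
  (* A linear form has order one at the origin, as seen in the direction [x0] where it does not
     vanish. *)
  apply: (ord_quotient (r := 1) (k := 1) (p1 := 0) (v1 := x0) lU lW fg') => //.
  + by rewrite addnAC -addnA.
  + exact: lU.1.
  + exact: lW.1.
  + by rewrite along_lform coefD coefC coefMX coefC /= add0r.
have [y [Uy Wy hy]] : exists y, [/\ U y, W y & lf h y != 0].
  apply: contrapT => nex; apply: nhW => y [Uy Wy]; rewrite /hker /=.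
  by apply/eqP/negPn/negP => hy; apply: nex; exists y.
apply: (ord_quotient (r := 0) (k := 0) (p1 := y) (v1 := y) lU lW fg') => //.
  by rewrite addn0; move: of_; rewrite add0n.
by rewrite along_coef0 ev_lform.
Qed.

(** [msize] is the degree plus one, so the conclusion means that the degree is at least [q * m].
    Orders and nonvanishing concern only the restriction to [U], which lets the bound pass to
    hyperplane sections. *)
Definition degb (q : nat) U (Ws : set (set 'rV[K]_n)) :=
  forall m f, (forall W, Ws W -> ord U W m f) ->
    (exists2 x, U x & ev f x != 0) -> (q * m < msize f)%N.

(** This ends the descent: a positive order along a [W] containing [U] already makes [f] vanish on
    [U]. *)
Lemma degb_cover q U Ws W : Ws W -> U `<=` W -> degb q U Ws.
Proof.
move=> WsW UW m f of_ [x Ux fx].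
case: m of_ => [|m] of_.
  rewrite muln0 lt0n msize_poly_eq0; apply: contraNneq fx => ->.
  by rewrite /ev meval0.
by move: fx; rewrite -(along_coef0 f x x) (of_ W) ?eqxx //; apply: UW.
Qed.

Lemma degb_mono q U (Ws Ws' : set (set 'rV[K]_n)) :
  (forall W', Ws' W' -> exists2 W, Ws W & U `&` W' `<=` W) ->
  degb q U Ws' -> degb q U Ws.
Proof.
move=> sub dU m f of_; apply: dU => W' /sub[W WsW W'W].
by apply: ord_subset W'W _; apply: of_.
Qed.

(* A polynomial of order [m] along the [W]'s vanishes on each of the [q]
   hyperplanes if its degree is less than [q * m]; dividing by the product of
   their equations costs [q] in the degree and at most [1] in the orders. *)
Lemma degb_step hs U (Ws : set (set 'rV[K]_n)) : lin U ->
  (forall W, Ws W -> lin W) -> uniq hs ->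
  (forall h h', h \in hs -> h' \in hs -> h <> h' ->
     exists x, [/\ U x, lf h x = 0 & lf h' x != 0]) ->
  (forall W, Ws W -> forall h h', h \in hs -> h' \in hs ->
     U `&` W `<=` hker h -> U `&` W `<=` hker h' -> h = h') ->
  (forall h, h \in hs -> degb (size hs) (U `&` hker h) Ws) ->
  degb (size hs) U Ws.
Proof.
move=> lU lWs uhs hdist Wdist dh; elim=> [|m IH] f of_ fn0.
  case: fn0 => x Ux fx; rewrite muln0 lt0n msize_poly_eq0.
  by apply: contraNneq fx => ->; rewrite /ev meval0.
rewrite ltnNge; apply/negP => szf.
have f0 h : h \in hs -> forall x, U x -> lf h x = 0 -> ev f x = 0.
  move=> hhs x Ux hx; apply/eqP/negPn/negP => fx.
  move: szf; rewrite leqNgt => /negP; apply; apply: (dh h hhs).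
    by move=> W WsW p v [Up _] Wp [Uv _]; apply: (of_ W).
  by exists x.
have [g [gn0 szg og]] := peel lU uhs hdist f0 fn0.
have : (size hs * m < msize g)%N.
  apply: IH => // W WsW; apply: og; first exact: lWs.
  apply: ord_leq (of_ W WsW).
  set a := fun h => _; rewrite -[m.+1]addn1 leq_add2l.
  rewrite -size_filter.
  (* Two distinct counted forms would both vanish on [W] inside [U], against [Wdist]; so the count
     is at most one. *)
  have: uniq (seq.filter a hs) by rewrite filter_uniq.
  case E: (seq.filter a hs) => [|h1 [|h2 t]] //= /andP[+ _].
  have /andP[/asboolP v1 m1] : a h1 && (h1 \in hs).
    by rewrite -mem_filter E mem_head.
  have /andP[/asboolP v2 m2] : a h2 && (h2 \in hs).
    by rewrite -mem_filter E !inE eqxx orbT.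
  by rewrite (Wdist W WsW h1 h2) ?mem_head.
by move: szf; rewrite mulnS; lia.
Qed.

End LinearForms.

(** * The plane *)

Section PlaneGrid.
Variable K : closedFieldType.
Implicit Types (x y : 'rV[K]_3).

Definition pt3 (a b c : K) : 'rV[K]_3 := \row_i [:: a; b; c]`_i.
Definition form3 (a b c : K) : 'cV[K]_3 := \col_i [:: a; b; c]`_i.

Lemma lf_form3 a b c x :
  lf (form3 a b c) x = a * x 0 0 + b * x 0 1 + c * x 0 2%:R.
Proof.
rewrite lfE !big_ord_recl big_ord0 !mxE /= addr0 addrA.
by congr (_ + _ + _); rewrite mulrC; congr (_ * x _ _); apply: val_inj.
Qed.

(** In plane coordinates (x, y, z), [vform a] is the vertical line x = a z and [hform c] the
    horizontal line y = c z. *)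
Definition vform (a : K) := form3 1 0 (- a).
Definition hform (c : K) := form3 0 1 (- c).

Lemma lf_vform a x : lf (vform a) x = x 0 0 - a * x 0 2%:R.
Proof. by rewrite lf_form3 mul1r mul0r addr0 mulNr. Qed.

Lemma lf_hform a x : lf (hform a) x = x 0 1 - a * x 0 2%:R.
Proof. by rewrite lf_form3 mul1r mul0r add0r mulNr. Qed.

Lemma lf_vform_pt3 a b c d : lf (vform a) (pt3 b c d) = b - a * d.
Proof. by rewrite lf_vform !mxE. Qed.

Lemma lf_hform_pt3 a b c d : lf (hform a) (pt3 b c d) = c - a * d.
Proof. by rewrite lf_hform !mxE. Qed.

Lemma vform_inj : injective vform.
Proof. by move=> a b /matrixP/(_ 2%:R 0); rewrite !mxE /= => /oppr_inj. Qed.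

Lemma hform_inj : injective hform.
Proof. by move=> a b /matrixP/(_ 2%:R 0); rewrite !mxE /= => /oppr_inj. Qed.

Lemma vform_neq_hform a b : vform a <> hform b.
Proof. by move/matrixP/(_ 0 0); rewrite !mxE /= => /eqP; rewrite oner_eq0. Qed.

(** On a line the hyperplanes are taken to be the marked points themselves, so [degb_cover] ends the
    descent after one step. *)
Lemma degb_line c (xs : seq K) : uniq xs ->
  degb (size xs) (hker (hform c))
    [set W | exists2 a, a \in xs & W = hker (vform a)].
Proof.
move=> uxs; rewrite -(size_map vform); apply: degb_step.
- exact: lin_hker.
- by move=> _ [a _ ->]; apply: lin_hker.
- by rewrite map_inj_uniq //; apply: vform_inj.
- move=> _ _ /mapP[a _ ->] /mapP[b _ ->] ab; exists (pt3 a c 1).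
  rewrite /hker /= lf_hform_pt3 !lf_vform_pt3 !mulr1 !subrr; split=> //.
  by rewrite subr_eq0; apply/eqP => e; apply: ab; rewrite e.
- move=> _ [d _ ->] _ _ /mapP[a _ ->] /mapP[b _ ->].
  have in_dc : (hker (hform c) `&` hker (vform d)) (pt3 d c 1).
    by split; rewrite /hker /= ?lf_hform_pt3 ?lf_vform_pt3 mulr1 subrr.
  move=> /(_ _ in_dc) + /(_ _ in_dc); rewrite /hker /= !lf_vform_pt3 !mulr1.
  by move=> /eqP + /eqP; rewrite !subr_eq0 => /eqP <- /eqP <-.
- move=> _ /mapP[a axs ->]; apply: degb_cover (@subIsetr _ _ _).
  by exists a.
Qed.

(** The hyperplanes are the vertical lines, which belong to the configuration, and the [t]
    horizontal ones. On each horizontal line the vertical lines cut out [size as_] points in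
    addition to its [t] marked points. *)
Lemma degb_grid (as_ : seq K) (t : nat) (c : 'I_t -> K) (xs : 'I_t -> seq K) :
  uniq as_ -> injective c ->
  (forall l, [/\ uniq (xs l), size (xs l) = t &
     forall a, a \in xs l -> a \notin as_]) ->
  degb (size as_ + t) setT
    [set W | (exists2 a, a \in as_ & W = hker (vform a)) \/
       exists l a, a \in xs l /\ W = hker (vform a) `&` hker (hform (c l))].
Proof.
move=> uas c_inj xsP.
pose hs := map vform as_ ++ map (hform \o c) (enum 'I_t).
have szhs : size hs = (size as_ + t)%N.
  by rewrite size_cat 2!size_map size_enum_ord.
have hsP h : h \in hs ->
    (exists2 a, a \in as_ & h = vform a) \/ exists l, h = hform (c l).
  by rewrite mem_cat => /orP[/mapP[a ? ->]|/mapP[l _ ->]];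
    [left; exists a | right; exists l].
have ne_add1 a : a + 1 - a != 0 :> K by rewrite addrC addKr oner_eq0.
rewrite -szhs; apply: degb_step.
- by split.
- by move=> _ [[a _ ->]|[l [a [_ ->]]]]; try apply: linI; apply: lin_hker.
- rewrite cat_uniq map_inj_uniq ?uas; last exact: vform_inj.
  rewrite map_inj_uniq ?enum_uniq ?andbT; last by move=> l l' /hform_inj/c_inj.
  apply/hasPn => _ /mapP[l _ ->]; apply/negP => /mapP[a _ /esym].
  exact: vform_neq_hform.
- move=> _ _ /hsP[[a _ ->]|[l ->]] /hsP[[b _ ->]|[l' ->]] ne.
  + exists (pt3 a 0 1); rewrite !lf_vform_pt3 !mulr1 subrr subr_eq0.
    by split=> //; apply/eqP => e; apply: ne; rewrite e.
  + exists (pt3 a (c l' + 1) 1).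
    by rewrite lf_vform_pt3 lf_hform_pt3 !mulr1 subrr.
  + exists (pt3 (b + 1) (c l) 1).
    by rewrite lf_vform_pt3 lf_hform_pt3 !mulr1 subrr.
  + exists (pt3 0 (c l) 1); rewrite !lf_hform_pt3 !mulr1 subrr subr_eq0.
    by split=> //; apply/eqP => e; apply: ne; rewrite e.
- move=> _ [[a aas ->]|[l [a [axs ->]]]] h h' /hsP hP /hsP hP' hW h'W.
    have vP h1 : ((exists2 a0, a0 \in as_ & h1 = vform a0) \/
        exists l, h1 = hform (c l)) -> setT `&` hker (vform a) `<=` hker h1 ->
        h1 = vform a.
      have in_a d : (setT `&` hker (vform a)) (pt3 a d 1).
        by split=> //; rewrite /hker /= lf_vform_pt3 mulr1 subrr.
      move=> [[b _ ->]|[l ->]].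
        move/(_ _ (in_a 0)); rewrite /hker /= lf_vform_pt3 mulr1 => /eqP.
        by rewrite subr_eq0 => /eqP ->.
      move/(_ _ (in_a (c l + 1))); rewrite /hker /= lf_hform_pt3 mulr1 => e.
      by move: (ne_add1 (c l)); rewrite e eqxx.
    by rewrite (vP h) // (vP h').
  have pP h1 : ((exists2 a0, a0 \in as_ & h1 = vform a0) \/
      exists l, h1 = hform (c l)) ->
      setT `&` (hker (vform a) `&` hker (hform (c l))) `<=` hker h1 ->
      h1 = hform (c l).
    have in_a : (setT `&` (hker (vform a) `&` hker (hform (c l))))
        (pt3 a (c l) 1).
      by do !split=> //;
        rewrite /hker /= ?lf_hform_pt3 ?lf_vform_pt3 mulr1 subrr.
    move=> [[b bas ->]|[l' ->]] /(_ _ in_a); rewrite /hker /=.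
      rewrite lf_vform_pt3 mulr1 => /eqP; rewrite subr_eq0 => /eqP eab.
      by have [_ _ /(_ a axs)] := xsP l; rewrite eab bas.
    by rewrite lf_hform_pt3 mulr1 => /eqP; rewrite subr_eq0 => /eqP ->.
  by rewrite (pP h) // (pP h').
- move=> _ /hsP[[a aas ->]|[l ->]].
    by apply: degb_cover (@subIsetr _ _ _); left; exists a.
  have [uxs szxs xsas] := xsP l.
  rewrite szhs -{1}szxs -size_cat setTI.
  have uas_xs : uniq (as_ ++ xs l).
    by rewrite cat_uniq uas uxs andbT /=; apply/hasPn => a; apply: xsas.
  apply: degb_mono (degb_line uas_xs).
  move=> _ [a + ->]; rewrite mem_cat => /orP[aas|axs].
    by exists (hker (vform a)); [left; exists a | apply: subIsetr].
  exists (hker (vform a) `&` hker (hform (c l))); first by right; exists l, a.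
  by rewrite setIC.
Qed.

End PlaneGrid.

(** * Semicontinuity through minors *)

(** Greedy choice: as long as fewer than [N] rows are chosen, a nonzero column of [cokermx] is
    killed by all of them, and a row not killing it is independent of them. *)
Lemma det_select (F : fieldType) (I : Type) (N : nat) (r : I -> 'rV[F]_N) :
  (forall c : 'cV[F]_N, c != 0 -> exists i, r i *m c != 0) ->
  exists sel : 'I_N -> I, \det (\matrix_a r (sel a)) != 0.
Proof.
move=> r_inj.
suff sel k : (k <= N)%N ->
    exists sel : 'I_k -> I, row_free (\matrix_a r (sel a)).
  have [s s_free] := sel N (leqnn N).
  by exists s; rewrite -unitfE -unitmxE -row_free_unit.
elim: k => [|k IH] kN.
  exists (fun a : 'I_0 => match notF (ltn_ord a) with end).
  by rewrite /row_free flatmx0 mxrank0.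
have [s s_free] := IH (ltnW kN); set A := \matrix_a r (s a) in s_free.
have [j cj] : exists j, col j (cokermx A) != 0.
  apply/existsP; rewrite -[X in is_true X]negbK negb_exists.
  apply/negP => /forallP c0; have : cokermx A = 0.
    apply/trmx_inj/row_matrixP => j; rewrite -tr_col trmx0 row0.
    by have := c0 j; rewrite negbK => /eqP ->; rewrite trmx0.
  move/(congr1 mxrank); rewrite mxrank_coker mxrank0 => e.
  by move: s_free kN; rewrite /row_free => /eqP <-; rewrite -subn_gt0 e.
have [i ri] := r_inj _ cj.
rewrite -addn1.
exists (fun a => match split a with inl b => s b | inr _ => i end).
have -> : \matrix_a r (match split a with inl b => s b | inr _ => i end) =
    col_mx A (r i).
  apply/matrixP => a b; rewrite !mxE; case: (split a) => c; rewrite ?mxE //.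
  by rewrite ord1.
apply: inj_row_free => u; rewrite -[u]hsubmxK mul_row_col => u0.
have u20 : rsubmx u = 0.
  have := congr1 (mulmx^~ (col j (cokermx A))) u0.
  rewrite mulmxDl -!mulmxA mul0mx.
  have -> : A *m col j (cokermx A) = 0.
    by rewrite colE mulmxA mulmx_coker mul0mx.
  rewrite mulmx0 add0r [rsubmx u]mx11_scalar mul_scalar_mx => /eqP.
  by rewrite scaler_eq0 (negPf ri) orbF => /eqP ->; rewrite raddf0.
move: u0; rewrite u20 mul0mx addr0 => /eqP.
by rewrite mulmx_free_eq0 // => /eqP ->; rewrite row_mx0.
Qed.

Section Minors.
Variables (K : closedFieldType) (S : comNzRingType) (n : nat).
Implicit Types (f : {mpoly K[n]}) (ms : seq 'X_{1..n})
  (phi : {rmorphism S -> K}).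

(** The contribution of the monomial [m] to the coefficient of T^i in f(x + T v), i.e. an entry of
    the linear system for the coefficients of f; the ring [S] holds the parameters. *)
Definition crow (x v : 'rV[S]_n) (i : nat) (m : 'X_{1..n}) : S :=
  (mmap1 (fun j => (x 0 j)%:P + (v 0 j)%:P * 'X) m)`_i.

(* A triple [(x, v, i)] stands for the condition on [f] that the coefficient
   of [T ^ i] in [f (x + T v)] vanishes. *)
Definition cond : Type := ('rV[S]_n * 'rV[S]_n * nat)%type.

Definition cond_coef (phi : {rmorphism S -> K}) (t : cond) f : K :=
  (along f (map_mx phi t.1.1) (map_mx phi t.1.2))`_t.2.

Definition minor_mx ms (sel : 'I_(size ms) -> cond) : 'M[S]_(size ms) :=
  \matrix_(a, b) crow (sel a).1.1 (sel a).1.2 (sel a).2 (nth 0%MM ms b).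

Lemma mpoly_sumE ms f : uniq ms -> {subset msupp f <= ms} ->
  f = \sum_(m <- ms) f@_m *: 'X_[m].
Proof.
move=> ums sub; rewrite [LHS]mpolyE.
rewrite [RHS](bigID (mem (msupp f))) /= [X in _ + X]big1 ?addr0; last first.
  by move=> m /memN_msupp_eq0 ->; rewrite scale0r.
rewrite -[RHS]big_filter; apply: perm_big; apply: uniq_perm.
- exact: msupp_uniq.
- exact: filter_uniq.
by move=> m; rewrite mem_filter andb_idr // => /sub.
Qed.

Lemma cond_coefE phi t ms f : uniq ms -> {subset msupp f <= ms} ->
  cond_coef phi t f =
  \sum_(b < size ms) phi (crow t.1.1 t.1.2 t.2 (nth 0%MM ms b)) *
     f@_(nth 0%MM ms b).
Proof.
move=> ums sub; rewrite /cond_coef /along.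
rewrite {1}(mpoly_sumE ums sub) raddf_sum coef_sum (big_nth 0%MM) big_mkord.
apply: eq_bigr => b _; rewrite /= mmapZ coefCM mmapX mulrC; congr (_ * _).
rewrite /crow -coef_map /mmap1 rmorph_prod; congr (nth 0 (polyseq _) _).
apply: eq_bigr => j _; rewrite rmorphXn; congr (_ ^+ _).
by rewrite rmorphD rmorphM /= map_polyX !map_polyC !mxE.
Qed.

Lemma minor_indep phi ms sel f : uniq ms -> {subset msupp f <= ms} ->
  phi (\det (@minor_mx ms sel)) != 0 ->
  (forall a, cond_coef phi (sel a) f = 0) -> f = 0.
Proof.
move=> ums sub; rewrite -det_map_mx => d0 cond0.
pose c : 'cV[K]_(size ms) := \col_b f@_(nth 0%MM ms b).
have : map_mx phi (minor_mx sel) *m c = 0.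
  apply/colP => a; rewrite !mxE -[RHS](cond0 a) (cond_coefE _ _ ums sub).
  by apply: eq_bigr => b _; rewrite !mxE.
move/(congr1 (mulmx (invmx (map_mx phi (minor_mx sel))))).
rewrite mulKmx ?mulmx0 ?unitmxE ?unitfE // => c0.
rewrite (mpoly_sumE ums sub) (big_nth 0%MM) big_mkord big1 // => b _.
by have := congr1 (fun A : 'cV_(size ms) => A b 0) c0;
  rewrite !mxE => ->; rewrite scale0r.
Qed.

(** When the conditions have no nonzero common solution at [phi], their rows, possibly infinitely
    many, have trivial common kernel, and [det_select] picks a square subsystem. *)
Lemma minor_exists phi ms (C : set cond) : uniq ms ->
  (forall f, {subset msupp f <= ms} -> f != 0 ->
     exists2 t, C t & cond_coef phi t f != 0) ->
  exists2 sel, (forall a, C (sel a)) & phi (\det (@minor_mx ms sel)) != 0.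
Proof.
move=> ums C_inj.
pose r (t : {t : cond | C t}) : 'rV[K]_(size ms) :=
  \row_b phi (crow (sval t).1.1 (sval t).1.2 (sval t).2 (nth 0%MM ms b)).
have [|sel dsel] := @det_select K _ _ r; last first.
  exists (fun a => sval (sel a)); first by move=> a; apply: (svalP (sel a)).
  rewrite -det_map_mx; congr (\det _ != 0): dsel.
  by apply/matrixP => a b; rewrite !mxE.
move=> c c0.
pose f : {mpoly K[n]} := \sum_(b < size ms) c b 0 *: 'X_[nth 0%MM ms b].
have fc (b : 'I_(size ms)) : f@_(nth 0%MM ms b) = c b 0.
  rewrite /f raddf_sum (bigD1 b) //= mcoeffZ mcoeffX eqxx mulr1.
  rewrite big1 ?addr0 // => b' b'b; rewrite mcoeffZ mcoeffX.
  by rewrite nth_uniq // (inj_eq val_inj) (negPf b'b) mulr0.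
have sub : {subset msupp f <= ms}.
  move=> m; rewrite mcoeff_msupp; apply: contraR => mms.
  rewrite /f raddf_sum big1 //= => b _; rewrite mcoeffZ mcoeffX.
  case: eqP => [e|]; last by rewrite mulr0.
  by move: mms; rewrite -e mem_nth.
have [|t Ct ft] := C_inj f sub.
  apply: contraNneq c0 => f0; apply/eqP/colP => b.
  by rewrite -fc f0 mcoeff0 mxE.
exists (exist _ t Ct); apply: contraNneq ft => rc0.
rewrite (cond_coefE _ _ ums sub).
have := congr1 (fun A : 'M_1 => A 0 0) rc0; rewrite !mxE => {2}<-.
by apply/eqP; apply: eq_bigr => b _; rewrite mxE fc.
Qed.

End Minors.

(** * Generic members of one-parameter families *)

Section Generic.
Variable K : closedFieldType.

(** Induction on the number of variables: [muni] reads [f] as a polynomial in the last one, whose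
    coefficients vanish at every point by [poly_ext]. *)
Lemma mpoly_eval_inj n (f : {mpoly K[n]}) : (forall x, f.@[x] = 0) -> f = 0.
Proof.
elim: n f => [|n IH] f f0.
  have f_const : f = (f@_0)%:MP.
    apply: msize1_polyC; rewrite msizeE; apply/bigmax_leqP_seq => m _ _.
    by rewrite mdegE big_ord0.
  by have := f0 (fun=> 0); rewrite f_const mevalC => ->; rewrite mpolyC0.
have muni0 : muni f = 0.
  apply/polyP => i; rewrite coef0; apply: IH => x.
  suff -> : ((muni f)`_i).@[x] = (map_poly (meval x) (muni f))`_i.
    rewrite (_ : map_poly _ _ = 0) ?coef0 //; apply: poly_ext => c.
    pose y (j : 'I_n.+1) := oapp x c (insub (val j)).
    rewrite horner0 -(f0 y) muniE raddf_sum horner_sum mevalE.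
    apply: eq_bigr => m _; rewrite /= map_polyZ /= map_polyXn.
    rewrite hornerZ hornerXn mevalZ mevalX big_ord_recr /= mulrA.
    congr (_ * _ * _); last by rewrite /y insubF ?ltnn.
    by apply: eq_bigr => j _; rewrite mnmE /y /= valK.
  by rewrite coef_map.
apply/mpolyP => m; rewrite mcoeff0.
pose rs (m : 'X_{1..n.+1}) := [multinom m (widen_ord (leqnSn n) i) | i < n].
have : ((muni f)`_(m ord_max))@_(rs m) = f@_m.
  rewrite muniE coef_sum raddf_sum /=.
  rewrite [in RHS](mpolyE f) raddf_sum /=; apply: eq_bigr => m' _.
  rewrite coefZ coefXn mcoeffZ mcoeffX.
  have -> : (m' == m) = (rs m' == rs m) && (m' ord_max == m ord_max).
    apply/eqP/andP => [-> //|[/eqP e1 /eqP e2]]; apply/mnmP => i.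
    case: (unliftP ord_max i) => [j ->|-> //].
    have := congr1 (fun m : 'X_{1..n} => m j) e1; rewrite !mnmE.
    by congr (m' _ = m _); apply: val_inj; rewrite /= /bump leqNgt ltn_ord.
  rewrite [m' ord_max == _]eq_sym; case: (m ord_max == _).
    by rewrite mulr1 andbT mcoeffZ mcoeffX eq_sym.
  by rewrite mulr0 andbF mcoeff0 mulr0.
by rewrite muni0 coef0 mcoeff0 => <-.
Qed.

Lemma ev_neq0 n (f : {mpoly K[n]}) : f != 0 -> exists x, ev f x != 0.
Proof.
move=> f0; apply: contrapT => nex; case/eqP: f0; apply: mpoly_eval_inj => x.
apply/eqP/negPn/negP => fx; apply: nex; exists (\row_i x i).
by move: fx; congr (_ != _); apply: meval_eq => i; rewrite mxE.
Qed.

Definition at_pt n (t : K) (P : 'rV[{poly K}]_n) : 'rV[K]_n :=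
  map_mx (horner_eval t) P.

Lemma natr_inj_char0 : [pchar K] =i pred0 ->
  injective (fun j : nat => j%:R : K).
Proof.
move=> char0.
suff leK (i j : nat) : (i <= j)%N -> i%:R = j%:R :> K -> i = j.
  move=> i j /= e; case/orP: (leq_total i j) => [/leK|/leK/(_ (esym e))] //.
  exact.
move=> ij /esym/eqP; rewrite -subr_eq0 -natrB // (pcharf0P _).1 //.
by rewrite subn_eq0 => ji; apply/eqP; rewrite eqn_leq ij.
Qed.

(** Lagrange interpolation at 0, ..., q - 1, which are distinct in characteristic 0. Every point of
    the curve is a linear combination of the prescribed values and so inherits their common linear
    equations. *)
Lemma interpolation n q (y : nat -> 'rV[K]_n) : [pchar K] =i pred0 ->
  exists P : 'rV[{poly K}]_n,
    (forall j, (j < q)%N -> at_pt j%:R P = y j) /\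
    forall h, (forall j, (j < q)%N -> lf h (y j) = 0) ->
      forall t, lf h (at_pt t P) = 0.
Proof.
move=> /natr_inj_char0 natK_inj.
case: q => [|q].
  exists 0; split=> // h _ t; rewrite /at_pt map_mx0; exact: lf0.
pose ell := tnth (@lagrange K q.+1 (fun j => j%:R)).
pose P : 'rV[{poly K}]_n :=
  \row_i \sum_(l < q.+1) (y l 0 i)%:P * (ell l : {poly K}).
have atP t : at_pt t P = \sum_(l < q.+1) (ell l : {poly K}).[t] *: y l.
  apply/rowP => i; rewrite !mxE summxE /horner_eval horner_sum.
  by apply: eq_bigr => l _; rewrite hornerM hornerC mxE mulrC.
exists P; split=> [j jq|h h0 t]; rewrite atP.
  have ellE l : (ell l : {poly K}).[j%:R] = (l == Ordinal jq)%:R.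
    exact: (lagrange_sample (ltn0Sn q) natK_inj l (Ordinal jq)).
  rewrite (bigD1 (Ordinal jq)) //= big1 ?addr0 => [|l lj].
    by rewrite ellE eqxx scale1r.
  by rewrite (ellE l) (negPf lj) scale0r.
rewrite /lf mulmx_suml summxE big1 // => l _.
by rewrite -/(lf h _) lfZ h0 // mulr0.
Qed.

(** Each [D i] has finitely many roots, and countably many finite sets do not exhaust an uncountable
    field. *)
Lemma generic_point (T : countType) (D : T -> {poly K}) :
  ~ countable (@setT K) -> (forall i, D i != 0) ->
  exists t, forall i, (D i).[t] != 0.
Proof.
move=> Kunc D0; apply: contrapT => nex; apply: Kunc.
apply: (@sub_countable _ _ _ (\bigcup_(i in @setT T) [set t | (D i).[t] = 0])).
  apply: subset_card_le => t _; apply: contrapT => nt.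
  apply: nex; exists t => i; apply/eqP => Dt; apply: nt; exists i => //.
apply: bigcup_countable => [|i _]; first exact: countableP.
apply: finite_set_countable.
have [r Dr] := closed_field_poly_normal (D i).
apply: (@sub_finite_set _ _ [set` r]); last exact: finite_seq.
move=> t /= /eqP; rewrite -rootE Dr rootZ ?lead_coef_eq0 //.
by rewrite root_prod_XsubC.
Qed.

(** For fixed [m] the bound says that a linear system on the polynomials of degree less than [q * m]
    has only the zero solution; [D] is a minor of this system, chosen to be nonzero at [t0]. *)
Lemma generic_degb n q (I : Type) (A : I -> set 'rV[{poly K}]_n) (t0 : K) m :
  degb q setT [set W | exists i, W = at_pt t0 @` A i] ->
  exists2 D : {poly K}, D.[t0] != 0 & forall t, D.[t] != 0 ->
    forall f, (forall i, ord setT (at_pt t @` A i) m f) ->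
    (exists2 x, setT x & ev f x != 0) -> (q * m < msize f)%N.
Proof.
move=> d0.
pose ms := [seq val b | b : 'X_{1..n < q * m}].
have ums : uniq ms by rewrite map_inj_uniq ?enum_uniq //; apply: val_inj.
have sub_ms f : {subset msupp f <= ms} <-> (msize f <= q * m)%N.
  split=> [sub|szf b bf].
    rewrite msizeE; apply/bigmax_leqP_seq => b /sub /mapP[b1 _ ->] _.
    exact: bmdeg.
  have b_lt : (mdeg b < q * m)%N by apply: leq_trans (msize_mdeg_lt bf) szf.
  by apply/mapP; exists (BMultinom b_lt); rewrite ?mem_enum.
pose C : set (cond {poly K} n) :=
  [set c | exists i X v l, [/\ A i X, (l < m)%N & c = (X, map_mx polyC v, l)]].
have atC t (v : 'rV[K]_n) : at_pt t (map_mx polyC v) = v.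
  by apply/rowP => i; rewrite !mxE /horner_eval hornerC.
have [|sel Csel dsel] :=
    @minor_exists K {poly K} n (horner_eval t0) ms C ums.
  move=> f /sub_ms szf f0; apply: contrapT => nC.
  have [x fx] := ev_neq0 f0.
  move: szf; rewrite leqNgt => /negP; apply; apply: d0; last by exists x.
  move=> _ [i ->] p v _ [X AX <-] _ l lm; apply/eqP/negPn/negP => fl.
  apply: nC; exists (X, map_mx polyC v, l); first by exists i, X, v, l.
  by rewrite /cond_coef /= -!/(at_pt _ _) atC.
exists (\det (minor_mx sel)) => // t Dt f of_ [x _ fx].
rewrite ltnNge; apply/negP => /sub_ms szf; case/eqP: fx.
rewrite (minor_indep (phi := horner_eval t) ums szf Dt) ?/ev ?meval0 // => a.
have [i [X [v [l [AX lm ->]]]]] := Csel a.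
rewrite /cond_coef /= -!/(at_pt _ _) atC.
by apply: (of_ i) => //; exists X.
Qed.

Definition pullback n l (M : 'M[K]_(n, l)) (f : {mpoly K[l]}) : {mpoly K[n]} :=
  mmap (@mpolyC n K) (fun i => lform (col i M)) f.

Lemma ev_pullback n l (M : 'M[K]_(n, l)) f x :
  ev (pullback M f) x = ev f (x *m M).
Proof.
rewrite /ev /pullback mmap_rmorph; apply: eq_mmap => [a|i] /=.
  exact: mevalC.
rewrite -/(ev (lform _) x) ev_lform lfE mxE.
by apply: eq_bigr => j _; rewrite mxE.
Qed.

Lemma along_pullback n l (M : 'M[K]_(n, l)) f p v :
  along (pullback M f) p v = along f (p *m M) (v *m M).
Proof.
apply: poly_ext => c; rewrite !horner_along ev_pullback.
by rewrite mulmxDl -scalemxAl.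
Qed.

Lemma msize_pullback n l (M : 'M[K]_(n, l)) f :
  (msize (pullback M f) <= msize f)%N.
Proof.
rewrite /pullback /mmap; apply: leq_trans (msize_sum _ _ _) _.
apply/bigmax_leqP_seq => m mf _; apply: leq_trans _ (msize_mdeg_lt mf).
rewrite mul_mpolyC; apply: leq_trans (msizeZ_le _ _) _; rewrite /mmap1 mdegE.
apply: (big_ind2 (fun (g : {mpoly K[n]}) d => (msize g <= d.+1)%N)).
- by rewrite msize1.
- by move=> g d g' d' gd gd'; rewrite -addnS; apply: msizeM_leq.
move=> i _; elim: (m i) => [|e IH]; first by rewrite expr0 msize1.
by rewrite exprS -(add1n e) -addnS; apply: msizeM_leq => //; apply: msize_lform.
Qed.

End Generic.

(** * Lines in special position *)

Section SpecialPosition.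
Variable K : closedFieldType.
Implicit Types (j : nat) (x : 'rV[K]_4) (y : 'rV[K]_3).

Definition pt4 (a b c d : K) : 'rV[K]_4 := \row_i [:: a; b; c; d]`_i.

(* All the planes pass through the point (0, 0, 0, 1); in the coordinates
   (xi, z, w) given by [emb j], plane [j] meets plane [j'] in the line
   [xi = j' w]. *)
Definition plane j : 'cV[K]_4 := \col_i [:: 1; j%:R; j%:R ^+ 2; 0]`_i.

Definition emb j : 'M[K]_(3, 4) :=
  \matrix_(i, l) (nth [::] [:: [:: j%:R; - 1; 0; 0]; [:: 0; 0; 0; 1];
                              [:: 0; - j%:R; 1; 0]] i)`_l.

Definition proj j : 'M[K]_(4, 3) :=
  \matrix_(i, l) (nth [::] [:: [:: 0; 0; 0]; [:: - 1; 0; 0];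
                              [:: - j%:R; 0; 1]; [:: 0; 1; 0]] i)`_l.

Lemma pt3E y : y = pt3 (y 0 0) (y 0 1) (y 0 2%:R).
Proof.
by apply/rowP; case=> [[|[|[|//]]] lt]; rewrite mxE /=; congr (y _ _);
  apply: val_inj.
Qed.

Lemma pt4E x : x = pt4 (x 0 0) (x 0 1) (x 0 2%:R) (x 0 3%:R).
Proof.
by apply/rowP; case=> [[|[|[|[|//]]]] lt]; rewrite mxE /=; congr (x _ _);
  apply: val_inj.
Qed.

Lemma emb_pt3 j a b c :
  pt3 a b c *m emb j = pt4 (j%:R * a) (- (a + j%:R * c)) c b.
Proof.
apply/rowP; case=> [[|[|[|[|//]]]] lt];
  rewrite !mxE !big_ord_recl big_ord0 !mxE /=; ring.
Qed.

Lemma proj_pt4 j a b c d :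
  pt4 a b c d *m proj j = pt3 (- b - j%:R * c) d c.
Proof.
apply/rowP; case=> [[|[|[|//]]] lt];
  rewrite !mxE !big_ord_recl big_ord0 !mxE /=; ring.
Qed.

Lemma lf_plane_pt4 j a b c d :
  lf (plane j) (pt4 a b c d) = a + j%:R * b + j%:R ^+ 2 * c.
Proof. by rewrite lfE !big_ord_recl big_ord0 !mxE /=; ring. Qed.

Lemma plane_emb j y : lf (plane j) (y *m emb j) = 0.
Proof. by rewrite (pt3E y) emb_pt3 lf_plane_pt4; ring. Qed.

Lemma proj_emb j y : y *m emb j *m proj j = y.
Proof.
by rewrite (pt3E y) emb_pt3 proj_pt4; congr pt3; ring.
Qed.

Lemma emb_proj j x : lf (plane j) x = 0 -> x *m proj j *m emb j = x.
Proof.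
rewrite (pt4E x); move: (x 0 0) (x 0 1) (x 0 2%:R) (x 0 3%:R) => a b c d.
rewrite lf_plane_pt4 => e; rewrite proj_pt4 emb_pt3; congr pt4; last by ring.
by apply/eqP; rewrite -subr_eq0 -[X in _ == X]oppr0 -e; apply/eqP; ring.
Qed.

Definition span2 n (u v : 'rV[K]_n) : set 'rV[K]_n :=
  [set x | exists c1 c2, x = c1 *: u + c2 *: v].

Lemma lin_span2 n (u v : 'rV[K]_n) : lin (span2 u v).
Proof.
split; first by exists 0, 0; rewrite !scale0r addr0.
move=> c _ _ [a1 [a2 ->]] [b1 [b2 ->]]; exists (c * a1 + b1), (c * a2 + b2).
by rewrite !scalerDl !scalerDr !scalerA addrACA.
Qed.

Definition trace_pt n (h : 'cV[K]_n) (u v : 'rV[K]_n) : 'rV[K]_n :=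
  lf h u *: v - lf h v *: u.

(* A line outside plane [j] meets it in its [trace_pt]; the line lies in the
   plane exactly when this vector is zero, hence the case distinction. *)
Definition trace j (inside : bool) u v : set 'rV[K]_3 :=
  if inside then [set y | exists2 x, span2 u v x & y = x *m proj j]
  else [set y | exists c, y = (c *: trace_pt (plane j) u v) *m proj j].

(** Restriction along [emb j] does not raise the degree, and [emb j] carries each [trace] into the
    section of its line by the plane. *)
Lemma degb_plane q j (I : Type) (inside : I -> bool) (u v : I -> 'rV[K]_4) :
  (forall i, inside i -> lf (plane j) (u i) = 0 /\ lf (plane j) (v i) = 0) ->
  degb q setT [set W | exists i, W = trace j (inside i) (u i) (v i)] ->
  degb q (hker (plane j)) [set W | exists i, W = span2 (u i) (v i)].
Proof.
move=> in_plane d m f of_ [x hx fx].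
apply: leq_trans _ (msize_pullback (emb j) f); apply: d; last first.
  by exists (x *m proj j) => //; rewrite ev_pullback emb_proj.
move=> _ [i ->] p w _ Wp _ l lm; rewrite along_pullback.
suff [x' hx' [Wx' ->]] : exists2 x', hker (plane j) x' &
    span2 (u i) (v i) x' /\ p *m emb j = x'.
  by apply: (of_ (span2 (u i) (v i))) => //; [exists i | apply: plane_emb].
move: Wp; rewrite /trace; case: ifP => [/in_plane[hu hv]|_].
  move=> [_ [c1 [c2 ->]] ->]; exists (c1 *: u i + c2 *: v i).
    by rewrite /hker /= lfP lfZ hu hv !mulr0 addr0.
  by split; [exists c1, c2 | rewrite emb_proj // lfP lfZ hu hv !mulr0 addr0].
move=> [c ->]; set x' := c *: _.
have hx' : lf (plane j) x' = 0.
  by rewrite lfZ /trace_pt lfB !lfZ mulrC [X in _ - X]mulrC subrr mul0r.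
exists x' => //; split; last exact: emb_proj.
exists (- (c * lf (plane j) (v i))), (c * lf (plane j) (u i)).
by rewrite /x' /trace_pt scalerBr !scalerA scaleNr addrC.
Qed.

End SpecialPosition.

(** * The configuration adapted to a single plane *)

Section Configuration.
Variables (K : closedFieldType) (q k t s : nat).
Hypothesis char0 : [pchar K] =i pred0.
Hypothesis qE : (k + t = q)%N.
Hypothesis q_gt0 : (0 < q)%N.
Hypothesis qk_le : (q * k <= s)%N.
Hypothesis tt_le : (t * t + k <= s)%N.

(* Line [a] lies in plane [a %% q] if [a < q * k], and in no plane
   otherwise; [outer_line j n] is the [n]-th line outside plane [j] and
   [outer_rank j] its inverse. *)
Definition inside (j a : nat) := (a < q * k)%N && (a %% q == j)%N.

Definition outer_rank (j a : nat) : nat :=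
  if (a < q * k)%N then (a %/ q * q.-1 + unbump j (a %% q))%N
  else (a - k)%N.

Definition outer_line (j n : nat) : nat :=
  if (n < q.-1 * k)%N then (n %/ q.-1 * q + bump j (n %% q.-1))%N
  else (n + k)%N.

(** The ratio xi / w at the point where an outer line meets plane [j]; for a line of plane j' this
    is j'. Free lines start at 2q, leaving q, ..., q + k - 1 to the lines inside the plane. *)
Definition abscissa (a : nat) : nat :=
  if (a < q * k)%N then (a %% q)%N else (q + q + a)%N.

(** The first [q.-1 * k] ranks run in rounds through the other planes, [bump] skipping [j]; later
    ranks are shifted by [k], the number of lines inside plane [j]. *)
Lemma outer_lineP j n : (j < q)%N -> (n < t * t)%N ->
  [/\ (outer_line j n < s)%N, ~~ inside j (outer_line j n) &
      outer_rank j (outer_line j n) = n].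
Proof.
move=> jq nt; rewrite /outer_line; case: (ltnP n (q.-1 * k)) => nk.
  have q1 : (0 < q.-1)%N.
    by rewrite lt0n; apply/eqP => q0; move: nk; rewrite q0 mul0n ltn0.
  have r_lt : (n %% q.-1 < q.-1)%N by rewrite ltn_mod.
  have b_lt : (bump j (n %% q.-1) < q)%N by rewrite /bump; case: leqP; lia.
  have i_lt : (n %/ q.-1 < k)%N by rewrite ltn_divLR // mulnC.
  set i := (n %/ q.-1)%N in i_lt *; set b := bump _ _ in b_lt *.
  have a_lt : (i * q + b < q * k)%N by nia.
  have ai : ((i * q + b) %/ q = i)%N by rewrite divnMDl // divn_small // addn0.
  have ab : ((i * q + b) %% q = b)%N by rewrite modnMDl modn_small.
  rewrite /inside /outer_rank a_lt ai ab; split; first exact: leq_trans qk_le.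
    by rewrite eq_sym neq_bump.
  by rewrite bumpK /i -divn_eq.
have a_ge : (n + k < q * k)%N = false by apply/negbTE; rewrite -leqNgt; nia.
rewrite /inside /outer_rank a_ge addnK; split=> //.
by apply: leq_trans tt_le; rewrite ltn_add2r.
Qed.

Lemma abscissa_outer_line j n : (j < q)%N ->
  (abscissa (outer_line j n) < q)%N || (q + q <= abscissa (outer_line j n))%N.
Proof.
move=> jq; rewrite /abscissa; case: ifP;
  by rewrite ?leq_addr ?orbT // ltn_mod q_gt0.
Qed.

(** Serves to make the [t] points on one horizontal line distinct. Outer lines in the same plane
    have ranks differing by a multiple of [q.-1], and distinct free lines have distinct
    abscissae. *)
Lemma abscissa_inj j n1 n2 : (j < q)%N -> (n1 <= n2 < n1 + t)%N ->
  (n2 < t * t)%N ->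
  abscissa (outer_line j n1) = abscissa (outer_line j n2) -> n1 = n2.
Proof.
move=> jq /andP[n12 n21] n2t.
have n1t : (n1 < t * t)%N by lia.
have [_ _ rk1] := outer_lineP jq n1t; have [_ _ rk2] := outer_lineP jq n2t.
rewrite /abscissa; case: ltnP => a1; case: ltnP => a2; last first.
- by move=> e; rewrite -rk1 -rk2; congr outer_rank; lia.
- by have := ltn_pmod (outer_line j n2) q_gt0; lia.
- by have := ltn_pmod (outer_line j n1) q_gt0; lia.
move: rk1 rk2; rewrite /outer_rank a1 a2 => rk1 rk2 e.
rewrite -rk1 -rk2 e in n12 n21 *.
(* A line with index below [q * k] forces [k] to be positive. *)
have tq : (t <= q.-1)%N by move: a1; case: (k) qE; lia.
have [q0|q_pos] := posnP q.-1; first by rewrite q0 !muln0.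
set d := q.-1 in tq q_pos n12 n21 *; set u := unbump _ _ in n12 n21 *.
set A1 := (_ %/ q)%N in n12 n21 *.
set A2 := (outer_line j n2 %/ q)%N in n12 n21 *.
suff -> : A1 = A2 by [].
apply/eqP; rewrite eqn_leq; apply/andP; split.
  by rewrite -(leq_pmul2r q_pos); lia.
by rewrite -ltnS -(ltn_pmul2r q_pos) mulSn; lia.
Qed.

(** [dir_u] and [dir_v] span line [a] of the configuration for plane [j]: inside it, the line xi =
    (q + a / q) w; in another plane, the line z = c w of that plane, which meets plane [j] at the
    same height; a free line passes through the point of plane [j] with prescribed abscissa and
    height. The height [c] numbers the horizontal line. *)
Definition dir_u (j a : nat) : 'rV[K]_4 :=
  let c := (outer_rank j a %/ t)%N%:R in
  if (a < q * k)%N then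
    if (a %% q == j)%N then pt3 (q + a %/ q)%N%:R 0 1 *m emb K j
    else pt3 0 c 1 *m emb K (a %% q)%N
  else pt3 (abscissa a)%:R c 1 *m emb K j.

Definition dir_v (j a : nat) : 'rV[K]_4 :=
  if (a < q * k)%N then
    if (a %% q == j)%N then pt3 0 1 0 *m emb K j
    else pt3 1 0 0 *m emb K (a %% q)%N
  else pt4 1 0 0 0.

Lemma dir_plane j a : (a < q * k)%N ->
  lf (plane K (a %% q)%N) (dir_u j a) = 0 /\
  lf (plane K (a %% q)%N) (dir_v j a) = 0.
Proof.
by move=> a_lt; rewrite /dir_u /dir_v a_lt; case: eqP => [->|_];
  rewrite !plane_emb.
Qed.

Lemma dir_v_outside j a : (j < q)%N -> ~~ inside j a ->
  lf (plane K j) (dir_v j a) != 0.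
Proof.
rewrite /inside /dir_v; case: (ltnP a (q * k)) => [_ jq /= aj|_ _ _].
  rewrite (negPf aj) emb_pt3 lf_plane_pt4 !mulr0 mulr1 addr0 addr0 mulrN mulr1.
  by rewrite subr_eq0 (inj_eq (natr_inj_char0 char0)).
by rewrite lf_plane_pt4 !mulr0 !addr0 oner_eq0.
Qed.

(** The outer line of rank [l * t + b] supplies marked point [b] of horizontal line [l]; the [k]
    lines inside the plane are the vertical lines of [degb_grid]. *)
Lemma degb_configuration j : (j < q)%N ->
  degb q setT
    [set W | exists a : 'I_s, W = trace j (inside j a) (dir_u j a) (dir_v j a)].
Proof.
move=> jq; have natK := natr_inj_char0 char0.
pose as_ : seq K := [seq (q + i)%N%:R | i <- iota 0 k].
pose xs (l : 'I_t) : seq K :=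
  [seq (abscissa (outer_line j (l * t + b)%N))%:R | b <- iota 0 t].
have n_lt (l : 'I_t) b : (b < t)%N -> (l * t + b < t * t)%N.
  by move=> bt; have := ltn_ord l; nia.
have := @degb_grid K as_ t (fun l => l%:R) xs; rewrite size_map size_iota qE.
move=> dg; apply: degb_mono (dg _ _ _).
- move=> _ [[_ /mapP[i + ->] ->]|[l [_ [/mapP[b + ->] ->]]]];
    rewrite mem_iota add0n => /andP[_ lt].
    have a_lt : (i * q + j < q * k)%N by nia.
    have as_lt : (i * q + j < s)%N by apply: leq_trans qk_le.
    have ai : ((i * q + j) %/ q = i)%N.
      by rewrite divnMDl // divn_small // addn0.
    have aj : ((i * q + j) %% q = j)%N by rewrite modnMDl modn_small.
    eexists; first by exists (Ordinal as_lt).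
    move=> y [_]; rewrite /hker /= lf_vform => /eqP.
    rewrite subr_eq0 => /eqP y0.
    rewrite /trace /inside /dir_u /dir_v /= a_lt aj eqxx /= ai.
    exists (y *m emb K j); last by rewrite proj_emb.
    exists (y 0 2%:R), (y 0 1); rewrite !scalemxAl -mulmxDl; congr (_ *m _).
    by rewrite {1}(pt3E y) y0; apply/rowP; case=> [[|[|[|//]]] ?];
      rewrite !mxE /=; ring.
  have [a_lt a_out a_rk] := outer_lineP jq (n_lt l b lt).
  eexists; first by exists (Ordinal a_lt).
  move=> y [_ []]; rewrite /hker /= lf_vform lf_hform => /eqP.
  rewrite subr_eq0 => /eqP y0 /eqP; rewrite subr_eq0 => /eqP y1.
  rewrite /trace (negPf a_out) /trace_pt /dir_u /dir_v /=.
  have -> : (outer_rank j (outer_line j (l * t + b)) %/ t = l)%N.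
    by rewrite a_rk divnMDl ?(leq_ltn_trans _ lt) // (divn_small lt) addn0.
  move: a_out y0; rewrite /inside /abscissa.
  case: (ltnP _ (q * k)) => [a_q /= aj|a_q _] y0.
    rewrite (negPf aj); set j' := (_ %% q)%N in aj y0 *.
    have jj' : j%:R - j'%:R != 0 :> K by rewrite subr_eq0 (inj_eq natK) eq_sym.
    (* In the coordinates of plane [j], the vector [trace_pt] is (j - j') times (j', l, 1); for a
       free line, below, it is minus the prescribed point. *)
    exists (y 0 2%:R / (j%:R - j'%:R)).
    rewrite !emb_pt3 !lf_plane_pt4 (pt3E y) y0 y1.
    rewrite -[LHS](proj_emb j) emb_pt3; congr (_ *m _).
    apply/rowP; case=> [[|[|[|[|//]]]] ?]; rewrite !mxE /=; field; exact: jj'.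
  exists (- y 0 2%:R); rewrite !emb_pt3 !lf_plane_pt4 (pt3E y) y0 y1.
  rewrite -[LHS](proj_emb j) emb_pt3; congr (_ *m _).
  by apply/rowP; case=> [[|[|[|[|//]]]] ?]; rewrite !mxE /=; ring.
- by rewrite map_inj_in_uniq ?iota_uniq // => i i' _ _ /natK/addnI.
- by move=> l l' /natK/val_inj.
move=> l; split; last first.
- move=> _ /mapP[b _ ->]; apply/mapP => -[i]; rewrite mem_iota => ik /natK e.
  by have := abscissa_outer_line (l * t + b) jq; rewrite e; lia.
- by rewrite size_map size_iota.
rewrite map_inj_in_uniq ?iota_uniq // => b b'.
rewrite !mem_iota !add0n => /andP[_ bt] /andP[_ bt'] /natK.
have := n_lt l b bt; have := n_lt l b' bt'.
case: (leqP b b') => bb' l1 l2 e.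
  have /addnI // : (l * t + b = l * t + b')%N by apply: abscissa_inj e; lia.
have /addnI // : (l * t + b' = l * t + b)%N.
by apply: abscissa_inj (esym e); lia.
Qed.

End Configuration.

(** As [u] and [v] may be dependent, a basis of their span is completed to one of the whole space
    and its first two vectors are kept. *)
Lemma line_through (K : fieldType) (u v : 'rV[K]_4) :
  exists L : line K, u \in val L /\ v \in val L.
Proof.
pose U := <<[:: u; v]>>%VS.
pose X := vbasis U ++ vbasis (U^C)%VS.
have X_basis : basis_of fullv X.
  rewrite -(addv_complf U); apply: cat_basis; try exact: vbasisP.
  by rewrite directv_addE /= -directv_addE; apply/directv_addP/capv_compl.
have szX : size X = 4%N.
  have /eqnP := basis_free X_basis; rewrite -/X => <-.
  by rewrite (span_basis X_basis) dimvf.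
pose Y := take 2 X.
have Yfree : free Y.
  have := basis_free X_basis; rewrite -[X](cat_take_drop 2) cat_free.
  by case/and3P.
have dimY : \dim <<Y>>%VS == 2.
  by move: Yfree; rewrite /free => /eqP ->; rewrite size_take szX.
have UY : (U <= <<Y>>)%VS.
  rewrite -(span_basis (vbasisP U)); apply: sub_span => w wU.
  rewrite /Y /X take_cat; case: ltnP => szU; last by rewrite mem_cat wU.
  by move: szU; rewrite size_tuple => /leq_trans/(_ (dim_span [:: u; v])).
exists (Sub <<Y>>%VS dimY); rewrite SubK.
by split; apply: (subvP UY); apply: memv_span; rewrite !inE eqxx ?orbT.
Qed.

Definition line_set (K : fieldType) (L : line K) : set 'rV[K]_4 :=
  [set x | x \in val L].

(** * One set of lines for all planes and all multiplicities *)

Section SpecialLines.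
Variables (K : closedFieldType) (q k t s : nat).
Hypothesis char0 : [pchar K] =i pred0.
Hypothesis K_uncountable : ~ countable (@setT K).
Hypothesis qE : (k + t = q)%N.
Hypothesis q_gt0 : (0 < q)%N.
Hypothesis qk_le : (q * k <= s)%N.
Hypothesis tt_le : (t * t + k <= s)%N.

Lemma at_ptM n l (t0 : K) (P : 'rV[{poly K}]_n) (M : 'M[K]_(n, l)) :
  at_pt t0 (P *m map_mx polyC M) = at_pt t0 P *m M.
Proof.
rewrite /at_pt map_mxM; congr (_ *m _).
by apply/matrixP => i j; rewrite !mxE /= /horner_eval hornerC.
Qed.

Lemma at_ptP n (t0 : K) (a b : {poly K}) (P Q : 'rV[{poly K}]_n) :
  at_pt t0 (a *: P + b *: Q) = a.[t0] *: at_pt t0 P + b.[t0] *: at_pt t0 Q.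
Proof. by rewrite /at_pt map_mxD !map_mxZ. Qed.

Definition lfX n (h : 'cV[K]_n) (P : 'rV[{poly K}]_n) : {poly K} :=
  (P *m map_mx polyC h) 0 0.

Lemma horner_lfX n (h : 'cV[K]_n) P t0 : (lfX h P).[t0] = lf h (at_pt t0 P).
Proof. by rewrite /lf -at_ptM mxE. Qed.

Definition traceX j (b : bool) (P Q : 'rV[{poly K}]_4) : set 'rV[{poly K}]_3 :=
  if b then [set X | exists c1 c2,
    X = (c1%:P *: P + c2%:P *: Q) *m map_mx polyC (proj K j)]
  else [set X | exists c,
    X = ((c%:P * lfX (plane K j) P) *: Q + (- c%:P * lfX (plane K j) Q) *: P)
        *m map_mx polyC (proj K j)].

Lemma at_pt_traceX t0 j b P Q :
  at_pt t0 @` traceX j b P Q = trace j b (at_pt t0 P) (at_pt t0 Q).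
Proof.
rewrite /traceX /trace; case: b; apply/seteqP; split.
- move=> _ [_ [c1 [c2 ->]] <-]; rewrite at_ptM at_ptP !hornerC.
  by eexists; first by exists c1, c2.
- move=> _ [_ [c1 [c2 ->]] ->]; eexists; first by exists c1, c2.
  by rewrite at_ptM at_ptP !hornerC.
- move=> _ [_ [c ->] <-]; exists c.
  rewrite at_ptM at_ptP !hornerM hornerN !hornerC !horner_lfX; congr (_ *m _).
  by rewrite /trace_pt scalerBr !scalerA mulNr scaleNr.
- move=> _ [c ->]; eexists; first by exists c.
  rewrite at_ptM at_ptP !hornerM hornerN !hornerC !horner_lfX; congr (_ *m _).
  by rewrite /trace_pt scalerBr !scalerA mulNr scaleNr.
Qed.

Lemma plane_inj : injective (plane K).
Proof.
move=> i j /matrixP/(_ 1 0); rewrite !mxE /= => /natr_inj_char0; exact.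
Qed.

(* [t0] avoids the zeros of countably many nonzero polynomials, the
   nonvanishing of the one for plane [j] being witnessed at [t0 = j]. *)
Lemma special_directions : exists u v : 'I_s -> 'rV[K]_4,
  [/\ forall j, (j < q)%N -> degb q setT
        [set W | exists a : 'I_s, W = trace j (inside q k j a) (u a) (v a)],
      forall a : 'I_s, (a < q * k)%N -> lf (plane K (a %% q)%N) (u a) = 0 /\
        lf (plane K (a %% q)%N) (v a) = 0 &
      forall (a : 'I_s) j, (j < q)%N -> ~~ inside q k j a ->
        lf (plane K j) (v a) != 0].
Proof.
have /choice[P PP] := fun a : 'I_s =>
  @interpolation K 4 q (fun j => dir_u K q k t j a) char0.
have /choice[Q QP] := fun a : 'I_s =>
  @interpolation K 4 q (fun j => dir_v K q k j a) char0.
have degb0 (j : 'I_q) : degb q setT [set W | exists a : 'I_s,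
    W = at_pt j%:R @` traceX j (inside q k j a) (P a) (Q a)].
  apply: degb_mono (degb_configuration char0 qE q_gt0 qk_le tt_le (ltn_ord j)).
  move=> _ [a ->]; eexists; first by exists a.
  by rewrite at_pt_traceX (PP a).1 // (QP a).1 //; apply: subIsetr.
have /choice[D DP] : forall i : 'I_q * nat, exists D : {poly K},
    D != 0 /\ forall t0, D.[t0] != 0 -> forall f,
    (forall a : 'I_s, ord setT
       (at_pt t0 @` traceX i.1 (inside q k i.1 a) (P a) (Q a)) i.2 f) ->
    (exists2 x, setT x & ev f x != 0) -> (q * i.2 < msize f)%N.
  move=> [j m]; have [D D0 DP] := generic_degb m (degb0 j).
  by exists D; split=> //; apply: contraNneq D0 => ->; rewrite horner0.
pose E (i : 'I_q * 'I_s) : {poly K} :=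
  if inside q k i.1 i.2 then 1 else lfX (plane K i.1) (Q i.2).
(* The first summand indexes the degree bound by plane and multiplicity, the second the
   transversality of a line to a plane not meant to contain it. *)
pose F (i : ('I_q * nat) + ('I_q * 'I_s)) : {poly K} :=
  match i with inl a => D a | inr a => E a end.
have [|t0 Ft0] := @generic_point K _ F K_uncountable.
  case=> [i|[j a]] /=; first by have [] := DP i.
  rewrite /E /=; case: ifPn => [_|ja]; first exact: oner_neq0.
  apply: contraNneq (dir_v_outside char0 (ltn_ord j) ja) => Q0.
  by rewrite -(QP a).1 // -horner_lfX Q0 horner0.
exists (fun a => at_pt t0 (P a)), (fun a => at_pt t0 (Q a)); split.
- move=> j jq m f of_; have [_ DPj] := DP (Ordinal jq, m).
  apply: DPj; first exact: (Ft0 (inl (Ordinal jq, m))).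
  by move=> a; apply: of_; exists a; rewrite at_pt_traceX.
(* A line meant to lie in a plane does so at every node, and interpolation keeps linear
   equations. *)
- move=> a a_lt; split; [apply: (PP a).2 | apply: (QP a).2] => j _.
    by have [] := dir_plane K t j a_lt.
  by have [] := dir_plane K t j a_lt.
- move=> a j jq ja; have := Ft0 (inr (Ordinal jq, a)).
  by rewrite /F /E /= (negPf ja) horner_lfX.
Qed.

(** [degb_step] is applied to the [q] planes: each span lies in at most one of them, because [v a]
    is off the others, and [degb_plane] gives the bound within each plane. *)
Lemma special_lines : exists L : 'I_s -> line K,
  degb q setT [set W | exists a, W = line_set (L a)].
Proof.
have [u [v [dj uv_in v_out]]] := special_directions.
have /choice[L LP] := fun a => line_through (u a) (v a).
exists L.
apply: (@degb_mono _ _ _ _ _ [set W | exists a, W = span2 (u a) (v a)]).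
  move=> _ [a ->]; eexists; first by exists a.
  move=> _ [_ [c1 [c2 ->]]]; rewrite /line_set /=.
  by have [ua va] := LP a; rewrite memvD ?memvZ.
have hsP h : h \in [seq plane K j | j <- iota 0 q] ->
    exists2 j, (j < q)%N & h = plane K j.
  by move=> /mapP[j]; rewrite mem_iota add0n => jq ->; exists j.
have -> : q = size [seq plane K j | j <- iota 0 q].
  by rewrite size_map size_iota.
apply: degb_step.
- by split.
- by move=> _ [a ->]; apply: lin_span2.
- by rewrite map_inj_uniq ?iota_uniq //; apply: plane_inj.
- move=> _ _ /hsP[i _ ->] /hsP[j _ ->] ij; exists (pt3 1 0 0 *m emb K i).
  split=> //; first exact: plane_emb.
  rewrite emb_pt3 lf_plane_pt4 !mulr0 mulr1 !addr0 mulrN mulr1 subr_eq0.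
  rewrite (inj_eq (natr_inj_char0 char0)); apply/eqP => e.
  by apply: ij; rewrite e.
- move=> _ [a ->] _ _ /hsP[i iq ->] /hsP[j jq ->].
  have va : (setT `&` span2 (u a) (v a)) (v a).
    by split=> //; exists 0, 1; rewrite scale0r scale1r add0r.
  move=> /(_ _ va) hi /(_ _ va) hj.
  have in_plane l : (l < q)%N -> lf (plane K l) (v a) = 0 -> (a %% q)%N = l.
    move=> lq hl; apply/eqP; have := v_out a l lq.
    by rewrite hl eqxx /inside; case: (_ == l); rewrite ?andbF // => /(_ isT).
  by rewrite -(in_plane i iq hi) -(in_plane j jq hj).
- move=> _ /hsP[j jq ->]; rewrite size_map size_iota setTI.
  apply: degb_plane (dj j jq) => a /andP[a_lt /eqP <-].
  exact: uv_in.
Qed.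

End SpecialLines.

(** * Pluecker coordinates *)

Section PluckerMinors.
Variables (K : closedFieldType) (s : nat).
Implicit Types (L : 'I_s -> line K) (a : 'I_s).
Local Notation PS := {mpoly K[#|plucker_index s|]}.

Definition pvar a (i j : 'I_4) : PS :=
  'X_(enum_rank ((a, (i, j)) : plucker_index s)).

(* The row space of the Pluecker matrix of a line is the line itself, so these
   products parametrize its points polynomially in the Pluecker coordinates. *)
Definition plucker_pt a (w : 'rV[K]_4) : 'rV[PS]_4 :=
  \row_j \sum_i w 0 i *: pvar a i j.

Definition block_deg (m : 'X_{1..#|plucker_index s|}) a : nat :=
  \sum_(i < 4) \sum_(j < 4) m (enum_rank ((a, (i, j)) : plucker_index s)).

Definition mhomog (D : 'I_s -> nat) (p : PS) :=
  forall m, m \in msupp p -> forall a, block_deg m a = D a.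

Lemma mhomog0 D : mhomog D 0.
Proof. by move=> m; rewrite msupp0. Qed.

Lemma mhomogD D p p' : mhomog D p -> mhomog D p' -> mhomog D (p + p').
Proof. by move=> hp hp' m /msuppD_le; rewrite mem_cat => /orP[/hp|/hp']. Qed.

Lemma mhomogZ D c p : mhomog D p -> mhomog D (c *: p).
Proof. by move=> hp m /msuppZ_le/hp. Qed.

Lemma mhomog_sum D (I : Type) (r : seq I) (P : pred I) (F : I -> PS) :
  (forall i, P i -> mhomog D (F i)) -> mhomog D (\sum_(i <- r | P i) F i).
Proof.
move=> hF; elim/big_ind: _ => //; first exact: mhomog0.
by move=> p p'; apply: mhomogD.
Qed.

Lemma mhomogM D D' p p' : mhomog D p -> mhomog D' p' ->
  mhomog (fun a => D a + D' a)%N (p * p').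
Proof.
move=> hp hp' m /msuppM_le /allpairsP[[m1 m2] /= [/hp h1 /hp' h2 ->]] a.
rewrite -h1 -h2 /block_deg -big_split; apply: eq_bigr => i _.
by rewrite -big_split; apply: eq_bigr => j _; rewrite mnmDE.
Qed.

Lemma eq_mhomog D D' p : mhomog D p -> D =1 D' -> mhomog D' p.
Proof. by move=> h e m mp a; rewrite h. Qed.

Lemma mhomogC c : mhomog (fun=> 0%N) c%:MP.
Proof.
move=> m; rewrite msuppC; case: ifP => // _; rewrite inE => /eqP -> a.
by rewrite /block_deg big1 // => i _; rewrite big1 // => j _; rewrite mnmE.
Qed.

Lemma mhomog_pvar a i j : mhomog (fun b => (b == a) : nat) (pvar a i j).
Proof.
move=> m; rewrite msuppX inE => /eqP -> b; rewrite /block_deg.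
under eq_bigr => i' _ do under eq_bigr => j' _ do
  rewrite mnm1E (inj_eq enum_rank_inj) !xpair_eqE.
rewrite (bigD1 i) //= (bigD1 j) //= !eqxx !andbT big1 => [|j' /negPf j'j].
  rewrite big1 ?addn0 => [|i' /negPf i'i]; first by rewrite eq_sym.
  by rewrite big1 // => j' _; rewrite [i == _]eq_sym i'i /= andbF.
by rewrite [j == _]eq_sym j'j !andbF.
Qed.

Lemma mhomog_prod (I : Type) (r : seq I) (F : I -> PS) (D : I -> 'I_s -> nat) :
  (forall i, mhomog (D i) (F i)) ->
  mhomog (fun a => \sum_(i <- r) D i a)%N (\prod_(i <- r) F i).
Proof.
move=> hF; elim: r => [|i r IH].
  rewrite big_nil -mpolyC1; apply: (eq_mhomog (@mhomogC 1)) => a.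
  by rewrite big_nil.
rewrite big_cons; apply: (eq_mhomog (mhomogM (hF i) IH)) => a.
by rewrite big_cons.
Qed.

Lemma mhomog_det n (A : 'M[PS]_n) (D : 'I_n -> 'I_s -> nat) :
  (forall i j, mhomog (D i) (A i j)) ->
  mhomog (fun a => \sum_i D i a)%N (\det A).
Proof.
move=> hA; rewrite /determinant; apply: mhomog_sum => sg _.
apply: (@eq_mhomog (fun a => 0 + \sum_i D i a)%N) => [|a]; last by rewrite add0n.
apply: mhomogM; last by apply: mhomog_prod => i.
rewrite -signr_odd; case: (odd _); rewrite ?expr1 ?expr0; last exact: mhomogC.
by rewrite -mpolyC1 -mpolyCN; apply: mhomogC.
Qed.

(** Homogeneity of total degree [e] in the coordinates of line [a] and the polynomial variable, the
    latter counted with degree one. *)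
Definition phomog a (e : nat) (Q : {poly PS}) := forall l,
  if (l <= e)%N then mhomog (fun b => (b == a) * (e - l))%N Q`_l else Q`_l = 0.

Lemma phomogM a e e' Q Q' : phomog a e Q -> phomog a e' Q' ->
  phomog a (e + e') (Q * Q').
Proof.
move=> hQ hQ' l; rewrite coefM; case: ifP => l_le.
  apply: mhomog_sum => i _; have := hQ i; have := hQ' (l - i)%N.
  case: ifP => [le1|_ ->]; last by rewrite mulr0 => _; apply: mhomog0.
  move=> h'; case: ifP => [le2 h|_ ->]; last by rewrite mul0r; apply: mhomog0.
  apply: (eq_mhomog (mhomogM h h')) => b.
  by rewrite -mulnDr; congr (_ * _)%N; have := ltn_ord i; lia.
apply: big1 => i _; have := hQ i; have := hQ' (l - i)%N.
case: ifP => [le1 _|_ -> _]; last by rewrite mulr0.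
case: ifP => [le2 _|_ ->]; last by rewrite mul0r.
by have := ltn_ord i; lia.
Qed.

Lemma phomog1 a : phomog a 0 1.
Proof.
move=> [|l]; rewrite coef1 //= -mpolyC1.
by apply: (eq_mhomog (@mhomogC 1)) => b; rewrite muln0.
Qed.

Lemma phomog_linear a w (v : 'rV[K]_4) j :
  phomog a 1 ((plucker_pt a w 0 j)%:P + (map_mx (@mpolyC _ K) v 0 j)%:P * 'X).
Proof.
move=> [|[|l]]; rewrite coefD coefC coefMX coefC /= ?addr0 ?add0r // mxE.
  by apply: mhomog_sum => i _; apply/mhomogZ; rewrite subn0;
    apply: (eq_mhomog (@mhomog_pvar a i j)) => b; rewrite muln1.
by apply: (eq_mhomog (@mhomogC _)) => b; rewrite muln0.
Qed.

Lemma phomog_mmap1 a w (v : 'rV[K]_4) (m : 'X_{1..4}) :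
  phomog a (mdeg m) (mmap1 (fun j => (plucker_pt a w 0 j)%:P +
    (map_mx (@mpolyC _ K) v 0 j)%:P * 'X) m).
Proof.
rewrite /mmap1 mdegE; elim/big_rec2: _ => [|i Q e _ IH]; first exact: phomog1.
apply: phomogM => //; elim: (m i) => [|d IHd]; first exact: phomog1.
by rewrite exprS -add1n; apply: phomogM => //; apply: phomog_linear.
Qed.

(** For monomials of one fixed degree the multidegree depends only on the row, which makes the
    minors multihomogeneous. *)
Lemma mhomog_crow a w v l (m : 'X_{1..4}) :
  mhomog (fun b => (b == a) * (mdeg m - l))%N
    (crow (plucker_pt a w) (map_mx (@mpolyC _ K) v) l m).
Proof.
have := phomog_mmap1 a w v m l; case: ifP => // _.
by rewrite /crow => ->; apply: mhomog0.
Qed.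

Definition plucker_conds (m : nat) : set (cond PS 4) :=
  [set c | exists a w v l, (l < m)%N /\
     c = (plucker_pt a w, map_mx (@mpolyC _ K) v, l)].

Definition monomials (d : nat) : seq 'X_{1..4} :=
  [seq m <- [seq val b | b : 'X_{1..4 < d.+1}] | mdeg m == d].

Lemma mem_monomials d m : (m \in monomials d) = (mdeg m == d).
Proof.
rewrite mem_filter; case: eqP => //= md.
have lt : (mdeg m < d.+1)%N by rewrite md.
by apply/mapP; exists (BMultinom lt); rewrite ?mem_enum.
Qed.

Lemma monomials_uniq d : uniq (monomials d).
Proof.
by apply: filter_uniq; rewrite map_inj_uniq ?enum_uniq //; apply: val_inj.
Qed.

Lemma sub_monomials d (f : {mpoly K[4]}) :
  {subset msupp f <= monomials d} <-> f \is d.-homog.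
Proof.
by split=> [sub|/dhomogP df m /df md]; [apply/dhomogP => m /sub|];
  rewrite mem_monomials ?md // => /eqP.
Qed.

Definition minor_family m d : set PS :=
  [set p | exists2 sel : 'I_(size (monomials d)) -> cond PS 4,
     forall b, plucker_conds m (sel b) & p = \det (minor_mx sel)].

(** The maximal minors all vanish exactly when some nonzero form of degree [d] has order [m] along
    every line. *)
Definition bad_lines m d : set ('I_s -> line K) :=
  [set L | forall p, minor_family m d p -> p.@[plucker_tuple L] = 0].

Lemma bad_lines_closed m d : zariski_closed (bad_lines m d).
Proof.
exists (minor_family m d); split=> // p [sel selC ->].
have /choice[aw awP] : forall b, exists x : 'I_s * 'rV[K]_4 * 'rV[K]_4 * nat,
    sel b = (plucker_pt x.1.1.1 x.1.1.2, map_mx (@mpolyC _ K) x.1.2, x.2).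
  by move=> b; have [a [w [v [l [_ ->]]]]] := selC b; exists (a, w, v, l).
exists (fun a => \sum_b (a == (aw b).1.1.1) * (d - (aw b).2))%N => mu mup a.
suff D_entry b b' : mhomog (fun a => (a == (aw b).1.1.1) * (d - (aw b).2))%N
    (minor_mx sel b b') by exact: (mhomog_det D_entry mup).
rewrite mxE awP /=.
set x := nth _ _ _; have /eqP <- : mdeg x == d.
  by rewrite -mem_monomials mem_nth.
exact: mhomog_crow.
Qed.

Local Notation at_line L := (meval (plucker_tuple L)).

Lemma at_line_pt L a w (B0 := (vbasis (val (L a)))`_0)
    (B1 := (vbasis (val (L a)))`_1) :
  map_mx (at_line L) (plucker_pt a w) =
  lf B0^T w *: B1 - lf B1^T w *: B0.
Proof.
apply/rowP => j; rewrite !mxE raddf_sum /= !lfE !mulr_suml -sumrB.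
apply: eq_bigr => i _; rewrite mevalZ /pvar mevalXU /plucker_tuple enum_rankK.
by rewrite /plucker -/B0 -/B1 !mxE; ring.
Qed.

Lemma vbasis_line (M : line K) (B0 := (vbasis (val M))`_0)
    (B1 := (vbasis (val M))`_1) :
  val M = (<[B0]> + <[B1]>)%VS /\ row_free (col_mx B0 B1).
Proof.
have := span_basis (vbasisP (val M)); have := basis_free (vbasisP (val M)).
rewrite /B0 /B1; move: (vbasis (val M)) => [B szB] /=; move: szB.
rewrite (eqP (valP M)); case: B => [|A0 [|A1 []]] //= _.
rewrite free_cons seq1_free span_seq1 => /andP[A01 A1n0] <-.
rewrite span_cons span_seq1; split=> //.
apply: inj_row_free => u; rewrite -[u]hsubmxK mul_row_col.
rewrite [lsubmx u]mx11_scalar [rsubmx u]mx11_scalar !mul_scalar_mx.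
move: (lsubmx u 0 0) (rsubmx u 0 0) => a b e.
have a0 : a = 0.
  apply: contraNeq A01 => a0; apply/vlineP; exists (- (a^-1 * b)).
  rewrite scaleNr -scalerA -scalerN -(addKr (a *: A0) (b *: A1)).
  by rewrite e addr0 opprK scalerA mulVf // scale1r.
move: e; rewrite a0 scale0r add0r => /eqP.
by rewrite scaler_eq0 (negPf A1n0) orbF => /eqP ->; rewrite raddf0 row_mx0.
Qed.

Lemma at_line_mem L a w : line_set (L a) (map_mx (at_line L) (plucker_pt a w)).
Proof.
rewrite at_line_pt; have [LE _] := vbasis_line (L a); move: LE.
set B0 := _`_0; set B1 := _`_1 => LE; rewrite /line_set /= {}LE addrC.
by rewrite memv_add // ?memvN memvZ ?memv_line.
Qed.

Lemma at_line_onto L a x : line_set (L a) x ->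
  exists w, map_mx (at_line L) (plucker_pt a w) = x.
Proof.
have := @at_line_pt L a; have [] := vbasis_line (L a).
set B0 := _`_0; set B1 := _`_1 => LE B_free ptE; rewrite /line_set /= {}LE.
move=> /memv_addP[_ /vlineP[c0 ->] [_ /vlineP[c1 ->] ->]].
(* The vector must pair to [c1] with [B0] and to [- c0] with [B1], which is solvable as [B0] and
   [B1] are independent. *)
pose y : 'cV[K]_4 := pinvmx (col_mx B0 B1) *m col_mx c1%:M (- c0)%:M.
have : col_mx B0 B1 *m y = col_mx c1%:M (- c0)%:M.
  by rewrite /y mulmxA mulmxVp // mul1mx.
rewrite mul_col_mx => /eq_col_mx[y0 y1]; exists y^T; rewrite ptE.
rewrite /lf -!trmx_mul y0 y1 !mxE /= !mulr1n scaleNr opprK addrC.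
by [].
Qed.

Lemma bad_linesP m d L f : ~ bad_lines m d L -> f \is d.-homog ->
  (forall a, ord setT (line_set (L a)) m f) -> f = 0.
Proof.
move=> nL /sub_monomials fd of_; apply: contrapT => f0; apply: nL.
move=> _ [sel selC ->]; apply/eqP/negPn/negP => det0; apply: f0.
apply: (minor_indep (phi := at_line L) (monomials_uniq d) fd det0) => b.
have [a [w [v [l [lm ->]]]]] := selC b; rewrite /cond_coef /=.
by apply: (of_ a) => //; apply: at_line_mem.
Qed.

(** At [L0] the degree bound excludes every nonzero form of degree [d] and order [m], so
    [minor_exists] yields a minor not vanishing there. *)
Lemma bad_lines_proper q m d L0 :
  degb q setT [set W | exists a, W = line_set (L0 a)] -> (d < q * m)%N ->
  bad_lines m d <> setT.
Proof.
move=> dL0 dqm badT; have : bad_lines m d L0 by rewrite badT.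
have [|sel selC det0 /(_ (\det (minor_mx sel)))] :=
    @minor_exists K PS 4 (at_line L0) (monomials d) (plucker_conds m)
      (monomials_uniq d); last first.
  by move=> bad; case/eqP: det0; apply: bad; exists sel.
move=> f /sub_monomials fd f0; apply: contrapT => nC.
have [x fx] := ev_neq0 f0.
have : (q * m < msize f)%N.
  apply: dL0; last by exists x.
  move=> _ [a ->] p v _ /at_line_onto[w <-] _ l lm; apply/eqP/negPn/negP => fl.
  apply: nC; exists (plucker_pt a w, map_mx (@mpolyC _ K) v, l).
    by exists a, w, v, l.
  rewrite /cond_coef /= (_ : map_mx (at_line L0) (map_mx _ v) = v) //.
  by apply/rowP => i; rewrite !mxE; apply: mevalC.
suff : (msize f <= d.+1)%N by lia.
rewrite msizeE; apply/bigmax_leqP_seq => mu mf _.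
by have /dhomogP/(_ mu mf) -> := fd.
Qed.

End PluckerMinors.

(** * Symbolic powers *)

Section SymbolicPowerTheory.
Variable S : idomainType.
Implicit Types (I P : set S) (f g c : S).

Lemma ideal_exp0 I m : ideal_exp I m 0.
Proof.
by exists 0%N, (fun=> 0), (fun _ _ => 0); split=> [[]|] //; rewrite big_ord0.
Qed.

Lemma ideal_expD I m f g :
  ideal_exp I m f -> ideal_exp I m g -> ideal_exp I m (f + g).
Proof.
move=> [n [c [h [Ih ->]]]] [n' [c' [h' [Ih' ->]]]].
exists (n + n')%N,
  (fun i => match split i with inl j => c j | inr j => c' j end),
  (fun i => match split i with inl j => h j | inr j => h' j end).
split; first by move=> i j; case: (split i).
rewrite big_split_ord /=; congr (_ + _); apply: eq_bigr => i _.
  by rewrite (unsplitK (inl i)).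
by rewrite (unsplitK (inr i)).
Qed.

Lemma ideal_exp_sum I m (J : Type) (r : seq J) (F : J -> S) :
  (forall j, ideal_exp I m (F j)) -> ideal_exp I m (\sum_(j <- r) F j).
Proof.
move=> IF; elim/big_ind: _ => //; first exact: ideal_exp0.
by move=> f g; apply: ideal_expD.
Qed.

Lemma ideal_exp_prod I m c (h : 'I_m -> S) :
  (forall j, I (h j)) -> ideal_exp I m (c * \prod_(j < m) h j).
Proof.
by move=> Ih; exists 1%N, (fun=> c), (fun=> h); split=> //; rewrite big_ord1.
Qed.

Lemma ideal_expM I m m' f g :
  ideal_exp I m f -> ideal_exp I m' g -> ideal_exp I (m + m') (f * g).
Proof.
move=> [n [c [h [Ih ->]]]] [n' [c' [h' [Ih' ->]]]].
rewrite mulr_suml; apply: ideal_exp_sum => i.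
rewrite mulr_sumr; apply: ideal_exp_sum => i'.
pose hh (j : 'I_(m + m')) :=
  match split j with inl l => h i l | inr l => h' i' l end.
suff -> : c i * \prod_(j < m) h i j * (c' i' * \prod_(j < m') h' i' j) =
    c i * c' i' * \prod_(j < m + m') hh j.
  by apply: ideal_exp_prod => j; rewrite /hh; case: (split j).
rewrite big_split_ord /= mulrACA; congr (_ * (_ * _)).
  by apply: eq_bigr => j _; rewrite /hh (unsplitK (inl j)).
by apply: eq_bigr => j _; rewrite /hh (unsplitK (inr j)).
Qed.

Lemma prime_idealP P : prime_ideal P ->
  [/\ ~ P 1 & forall f g, ~ P f -> ~ P g -> ~ P (f * g)].
Proof.
move=> [[_ + _] Pprime]; rewrite notin_setE => P1; split=> // f g nf ng.
have := Pprime f g; rewrite !in_setE => Pfg /[dup] /mem_set fgP Pfg'.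
by have /orP[|] := Pprime f g fgP; rewrite in_setE.
Qed.

Lemma ideal_exp_symbolic I m : ideal_exp I m `<=` symbolic_power I m.
Proof.
move=> f If P [/prime_idealP[P1 _] _] /=; exists f, 1; split=> //.
by rewrite tofrac1 divr1.
Qed.

Lemma symbolic_powerM I m m' f g : symbolic_power I m f ->
  symbolic_power I m' g -> symbolic_power I (m + m') (f * g).
Proof.
move=> sf sg P AP; have [/prime_idealP[_ Pmul] _] := AP.
have [a [b [Ia Pb fE]]] := sf P AP; have [a' [b' [Ia' Pb' gE]]] := sg P AP.
exists (a * a'), (b * b'); split; first exact: ideal_expM.
  exact: Pmul.
by rewrite !tofracM fE gE mulf_div.
Qed.

Lemma symbolic_power_lift I m P f : Ass I P -> symbolic_power I m f ->
  exists2 g, ~ P g & ideal_exp I m (g * f).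
Proof.
move=> AP sf; have [a [g [Ia Pg fE]]] := sf P AP; exists g => //.
have g0 : tofrac g != 0.
  rewrite tofrac_eq0; apply/eqP => g0; apply: Pg; rewrite g0.
  by have [[[+ _ _] _] _] := AP; rewrite in_setE.
suff -> : g * f = a by [].
by apply/eqP; rewrite -tofrac_eq tofracM fE mulrC divfK.
Qed.

End SymbolicPowerTheory.

(** * Symbolic powers of the ideal of lines and multiplicity *)

Section LinesIdeal.
Variables (K : closedFieldType) (s : nat) (L : 'I_s -> line K).
Implicit Types (f g : {mpoly K[4]}) (a : 'I_s).

Lemma alongM n (f g : {mpoly K[n]}) p v :
  along (f * g) p v = along f p v * along g p v.
Proof. by apply: poly_ext => c; rewrite hornerM !horner_along evM. Qed.

Lemma alongD n (f g : {mpoly K[n]}) p v :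
  along (f + g) p v = along f p v + along g p v.
Proof. by apply: poly_ext => c; rewrite hornerD !horner_along evD. Qed.

Lemma ord_mul n (U W : set 'rV[K]_n) m m' (f g : {mpoly K[n]}) :
  ord U W m f -> ord U W m' g -> ord U W (m + m') (f * g).
Proof.
move=> of_ og p v Up Wp Uv i im; rewrite alongM coefM big1 // => j _.
have [jm|mj] := ltnP j m; first by rewrite of_ ?mul0r.
by rewrite og ?mulr0 //; have := ltn_ord j; lia.
Qed.

Lemma ord_ideal_exp (U W : set 'rV[K]_4) (I : set {mpoly K[4]}) m f :
  (forall h, I h -> ord U W 1 h) -> ideal_exp I m f -> ord U W m f.
Proof.
move=> oI [n [c [h [Ih ->]]]].
elim/big_ind: _ => [p v _ _ _ i _|f1 f2 o1 o2 p v Up Wp Uv i im|i _].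
- by rewrite /along mmap0 coef0.
- by rewrite alongD coefD o1 ?o2 ?addr0.
have o0 : ord U W 0 (c i) by [].
rewrite -[m in ord _ _ m]add0n; apply: ord_mul => //.
elim: m h Ih => [|m IH] h Ih; first by [].
rewrite big_ord_recr /=; apply: (ord_leq (m := (m + 1)%N)).
  by rewrite addn1.
apply: ord_mul; last exact: oI.
by apply: (IH (fun i j => h i (widen_ord (leqnSn m) j))) => l j; apply: Ih.
Qed.

Lemma lin_line_set (M : line K) : lin (line_set M).
Proof.
split=> [|c x y]; rewrite /line_set /= ?mem0v // => xM yM.
by rewrite memvD ?memvZ.
Qed.

Definition line_ideal a : set {mpoly K[4]} :=
  [set f | forall x, line_set (L a) x -> ev f x = 0].

(** The case [m = 1], [r = 0] of [ord_quotient], based at a point of the line where [f] does not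
    vanish. *)
Lemma line_ideal_prime a f g :
  line_ideal a (f * g) -> line_ideal a f \/ line_ideal a g.
Proof.
move=> fg; have [|nf] := pselect (line_ideal a f); first by left.
right; have [x [Lx fx]] : exists x, line_set (L a) x /\ ev f x != 0.
  apply: contrapT => nex; apply: nf => x Lx; apply/eqP/negPn/negP => fx.
  by apply: nex; exists x.
move=> y Ly; apply: ((ord_one setT (line_set (L a)) g).1 _ y) => //.
apply: (ord_quotient (F := f * g) (g := f)
  (r := 0) (k := 0) (p1 := x) (v1 := x)) => //.
- exact: lin_line_set.
- by move=> z _; rewrite evM.
- by apply/ord_one => z _; apply: fg.
- by rewrite along_coef0.
Qed.

Lemma prime_line_ideal a : prime_ideal (line_ideal a).
Proof.
split; first split.
- by rewrite in_setE => x _; rewrite /ev meval0.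
- apply/negP; rewrite in_setE => /(_ 0 (lin_line_set _).1).
  by rewrite /ev meval1 => /eqP; rewrite oner_eq0.
- move=> c f g; rewrite !in_setE => hf hg x Lx.
  by rewrite evD evM hf // hg // mulr0 addr0.
move=> f g; rewrite !in_setE => /line_ideal_prime[h|h]; apply/orP.
  by left; rewrite in_setE.
by right; rewrite in_setE.
Qed.

Lemma separating_form (M : line K) (x : 'rV[K]_4) : x \notin val M ->
  exists h : 'cV[K]_4, (forall y, y \in val M -> lf h y = 0) /\ lf h x != 0.
Proof.
move=> xM; pose g : 'End('rV[K]_4) := (\1 - projv (val M))%VF.
have gE y : y *m lin1_mx g = y - projv (val M) y.
  rewrite mul_rV_lin1 /= /g.
  by rewrite !lfunE /= !lfunE /=.
have gj j y : lf (col j (lin1_mx g)) y = (y - projv (val M) y) 0 j.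
  by rewrite -gE lfE mxE; apply: eq_bigr => i _; rewrite mxE.
have [j xj] : exists j, (x - projv (val M) x) 0 j != 0.
  apply: contrapT => nex; case/negP: xM.
  suff /eqP : x - projv (val M) x = 0.
    by rewrite subr_eq0 => /eqP ->; apply: memv_proj.
  apply/rowP => j; rewrite [RHS]mxE; apply/eqP/negPn/negP => xj.
  by apply: nex; exists j.
exists (col j (lin1_mx g)); split=> [y yM|]; rewrite gj //.
by rewrite projv_id // subrr mxE.
Qed.

(** The prime is the colon ideal of a product of forms, each vanishing on one of the other lines but
    not identically on [L a]. *)
Lemma line_ideal_Ass a : Ass (lines_ideal L) (line_ideal a).
Proof.
split; first exact: prime_line_ideal.
have /choice[h hP] : forall b, exists h : {mpoly K[4]},
    ~ line_ideal a h /\ (val (L b) <> val (L a) -> line_ideal b h).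
  move=> b; have [ab|nab] := pselect (val (L b) = val (L a)).
    (* The lines may coincide; a repetition of [L a] contributes the factor 1. *)
    exists 1; split=> // /(_ 0 (lin_line_set _).1).
    by rewrite /ev meval1 => /eqP; rewrite oner_eq0.
  have [x xa xb] : exists2 x, x \in val (L a) & x \notin val (L b).
    apply/subvPn; apply/negP => sub; apply: nab; apply/esym/eqP.
    by rewrite eqEdim sub (eqP (valP (L a))) (eqP (valP (L b))).
  have [h [hb hx]] := separating_form xb; exists (lform h); split.
    by move=> /(_ x xa); rewrite ev_lform => /eqP; apply/negP.
  by move=> _ y yb; rewrite ev_lform hb.
exists (\prod_b h b); apply/seteqP; split=> g.
  move=> ga b y yb; have [e|ne] := pselect (val (L b) = val (L a)).
    by rewrite -/(ev _ y) evM ga ?mul0r // /line_set /= -e.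
  by rewrite -/(ev _ y) (bigD1 b) //= !evM (hP b).2 // mul0r mulr0.
move=> /(_ a) /(@line_ideal_prime a)[//|ha]; exfalso; move: ha.
elim/big_ind: _ => [ha|f1 f2 n1 n2 /line_ideal_prime[/n1|/n2]|b _] //.
  by have [[_ + _] _] := prime_line_ideal a; rewrite notin_setE; apply.
exact: (hP b).1.
Qed.

(** Clearing the denominator gives a multiple [g * f] in the ordinary power with [g] not identically
    zero on the line, and [ord_quotient] removes [g]. *)
Lemma symbolic_power_ord a m f : symbolic_power (lines_ideal L) m f ->
  ord setT (line_set (L a)) m f.
Proof.
move=> /(symbolic_power_lift (line_ideal_Ass a))[g ng gf].
have [x [Lx gx]] : exists x, line_set (L a) x /\ ev g x != 0.
  apply: contrapT => nex; apply: ng => x Lx; apply/eqP/negPn/negP => fx.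
  by apply: nex; exists x.
apply: (ord_quotient (F := g * f) (g := g)
  (r := 0) (k := 0) (p1 := x) (v1 := x)) => //.
- exact: lin_line_set.
- by move=> z _; rewrite evM.
- rewrite addn0; apply: ord_ideal_exp gf => h Ih.
  by apply/ord_one => y _; apply: Ih.
- by rewrite along_coef0.
Qed.

(** One takes the product of the equations of planes, one through each line; its powers ensure that
    the initial degrees are attained. *)
Lemma lines_ideal_homog : exists d f,
  [/\ lines_ideal L f, f != 0 & f \is d.-homog].
Proof.
have /choice[h hP] : forall a, exists h : 'cV[K]_4,
    lform h != 0 /\ line_ideal a (lform h).
  move=> a; have [x xa] : exists x, x \notin val (L a).
    have : ~~ (fullv <= val (L a))%VS.
      by apply/negP => /dimvS; rewrite (eqP (valP (L a))) dimvf.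
    by move=> /subvPn[x _ xa]; exists x.
  have [h [ha hx]] := separating_form xa; exists h; split.
    by apply: contraNneq hx => h0; rewrite -ev_lform h0 /ev meval0.
  by move=> y ya; rewrite ev_lform ha.
exists s, (\prod_a lform (h a)); split.
- move=> a y ya; rewrite -/(ev _ y) (bigD1 a) //= evM.
  by rewrite (hP a).2 // mul0r.
- by apply/prodf_neq0 => a _; have [] := hP a.
rewrite -[s in s.-homog]card_ord -sum1_card.
elim/big_rec2: _ => [|a f d _ IH]; first exact: dhomog1.
apply: dhomogM => //; apply: rpred_sum => i _; apply: rpredZ.
by rewrite dhomogX; apply/eqP; apply: mdeg1.
Qed.

End LinesIdeal.

(** * The Waldschmidt constant *)

(** Choose [m] with quotient close to the infimum and divide [n] by [m]: subadditivity bounds [a n]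
    by [n %/ m * a m] plus a constant [M] covering all remainders. *)
Lemma fekete (R : realType) (a : nat -> nat) :
  (forall m n, (a (m + n) <= a m + a n)%N) ->
  (fun n => (a n)%:R / n%:R : R) @ \oo -->
    inf [set (a m)%:R / m%:R | m in [set m | (0 < m)%N]].
Proof.
move=> a_sub; set E := [set _ | _ in _].
have E0 : lbound E 0 by move=> _ [m m0 <-]; rewrite divr_ge0.
have E_inf : has_inf E by split; [exists ((a 1)%:R / 1%:R), 1%N | exists 0].
apply/cvgrPdist_lt => e e0.
have e2 : 0 < e / 2 by rewrite divr_gt0.
have [_ [m m0 <-] am] := inf_adherent e2 E_inf.
have m0' : 0 < m%:R :> R by rewrite ltr0n.
pose M := (\sum_(r < m) a r)%N.
have a_le n : (a n <= n %/ m * a m + M)%N.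
  have aX i r : (a (i * m + r) <= i * a m + a r)%N.
    elim: i => [|i IH]; first by rewrite !mul0n !add0n.
    rewrite !mulSn -!addnA; apply: leq_trans (a_sub _ _) _.
    by rewrite leq_add2l.
  rewrite {1}(divn_eq n m); apply: leq_trans (aX _ _) _; rewrite leq_add2l.
  have r_lt : (n %% m < m)%N by rewrite ltn_mod.
  by rewrite /M (bigD1 (Ordinal r_lt)) //= leq_addr.
have [N NM] : exists N : nat, M%:R / (e / 2) < N%:R :> R.
  exists (Num.bound (M%:R / (e / 2))); apply: archi_boundP.
  by rewrite divr_ge0 // ltW.
exists N.+1 => // n /= Nn.
have n0 : 0 < n%:R :> R by rewrite ltr0n; apply: leq_trans Nn.
have inf_le : inf E <= (a n)%:R / n%:R.
  apply: ge_inf; first by exists 0.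
  by exists n => //=; apply: leq_trans Nn.
rewrite distrC ger0_norm ?subr_ge0 // ltrBlDl.
suff : (a n)%:R / n%:R < (a m)%:R / m%:R + e / 2 :> R by lra.
have Mn : M%:R / n%:R < e / 2.
  rewrite ltr_pdivrMr // mulrC -ltr_pdivrMr //; apply: lt_le_trans NM _.
  by rewrite ler_nat ltnW.
have quo : (n %/ m)%N%:R * (a m)%:R / n%:R <= (a m)%:R / m%:R :> R.
  rewrite ler_pdivrMr // mulrAC ler_pdivlMr // mulrAC [leRHS]mulrC.
  by rewrite ler_wpM2r // -natrM ler_nat leq_divM.
apply: le_lt_trans (_ : (n %/ m * a m + M)%N%:R / n%:R < _).
  by rewrite ler_pM2r ?invr_gt0 // ler_nat.
by rewrite natrD natrM mulrDl; lra.
Qed.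

Section WaldschmidtBound.
Variables (R : realType) (K : closedFieldType) (s : nat) (L : 'I_s -> line K).
Local Notation sp m := (symbolic_power (lines_ideal L) m).

Lemma symbolic_power_nonzero m : exists t, nonzero_degree_part (sp m) t.
Proof.
have [d [f [If f0 fd]]] := lines_ideal_homog L.
exists (d * m)%N, (f ^+ m); split.
- apply: ideal_exp_symbolic; rewrite -(card_ord m) -prodr_const.
  rewrite -[X in ideal_exp _ _ X]mul1r.
  by rewrite card_ord; apply: ideal_exp_prod.
- exact: expf_neq0.
- exact: dhomogMn.
Qed.

Lemma initial_degreeP (I : set {mpoly K[4]}) :
  (exists t, nonzero_degree_part I t) ->
  nonzero_degree_part I (initial_degree I) /\
  forall u, nonzero_degree_part I u -> (initial_degree I <= u)%N.
Proof.
move=> [t It]; apply: (@xgetPex _ _ [set t | nonzero_degree_part I t /\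
  forall u, nonzero_degree_part I u -> (t <= u)%N]).
have ex : exists t, `[< nonzero_degree_part I t >] by exists t; apply/asboolP.
case: (ex_minnP ex) => n /asboolP In nmin; exists n; split=> // u Iu.
by apply: nmin; apply/asboolP.
Qed.

Lemma initial_degree_sub m n :
  (initial_degree (sp (m + n)) <=
   initial_degree (sp m) + initial_degree (sp n))%N.
Proof.
have [_ mn_min] := initial_degreeP (symbolic_power_nonzero (m + n)).
have [[f [sf f0 fd]] _] := initial_degreeP (symbolic_power_nonzero m).
have [[g [sg g0 gd]] _] := initial_degreeP (symbolic_power_nonzero n).
apply: mn_min; exists (f * g); split; first exact: symbolic_powerM.
  by rewrite mulf_neq0.
exact: dhomogM.
Qed.

Lemma waldschmidt_ge (q : nat) :
  (forall m d, nonzero_degree_part (sp m) d -> (q * m <= d)%N) ->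
  q%:R <= waldschmidt R (lines_ideal L).
Proof.
move=> qm; have := @fekete R _ initial_degree_sub.
move=> /(cvg_lim (@Rhausdorff R)); rewrite /waldschmidt => ->.
apply: lb_le_inf.
  by exists (initial_degree (sp 1))%:R; exists 1%N => //; rewrite divr1.
move=> _ [m m0 <-]; rewrite ler_pdivlMr ?ltr0n // -natrM ler_nat.
by apply: qm; have [] := initial_degreeP (symbolic_power_nonzero m).
Qed.

End WaldschmidtBound.

Lemma very_general_bound (R : realType) (K : closedFieldType) (s q k t : nat) :
  [pchar K] =i pred0 -> ~ countable (@setT K) ->
  (k + t = q)%N -> (0 < q)%N -> (q * k <= s)%N -> (t * t + k <= s)%N ->
  for_very_general_lines
    (fun L : 'I_s -> line K => q%:R <= waldschmidt R (lines_ideal L)).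
Proof.
move=> char0 Kunc qE q_gt0 qk_le tt_le.
have [L0 dL0] := special_lines char0 Kunc qE q_gt0 qk_le tt_le.
(* Numbers encoding no pair, and pairs with [q * m <= d], are sent to [(1, 0)], which satisfies
   [0 < q * 1]; thus every set in the sequence is proper. *)
pose md n : nat * nat := odflt (1, 0)%N (unpickle n).
pose md' n := if ((md n).2 < q * (md n).1)%N then md n else (1, 0)%N.
exists (fun n => @bad_lines K s (md' n).1 (md' n).2); split=> [n|L nL].
  split; first exact: bad_lines_closed.
  by apply: (bad_lines_proper dL0); rewrite /md'; case: ifP => //; rewrite muln1.
apply: waldschmidt_ge => m d [f [sf f0 fd]]; rewrite leqNgt; apply/negP => dqm.
case/eqP: f0; apply: (@bad_linesP K s m d L) fd _ => [bad|a]; last first.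
  exact: symbolic_power_ord.
apply: nL; exists (pickle (m, d)) => //.
by rewrite /md' /md pickleK /= dqm.
Qed.

Theorem theorem3 (R : realType) (K : closedFieldType)
    (K_char0 : [pchar K] =i pred0)
    (K_uncountable : ~ countable (@setT K))
    (s : nat) (k q : int) (s_ge1 : (1 <= s)%N)
    (qk_le_s : q * k <= s%:Z)
    (sq_le : (q - k) ^+ 2 <= s%:Z - k) :
  for_very_general_lines
    (fun L : 'I_s -> line K => q%:~R <= waldschmidt R (lines_ideal L)).
Proof.
suff [q' [k' [t' [qq' q'_gt0 q'E qk' tt']]]] : exists q' k' t' : nat,
    [/\ q <= q'%:Z, (0 < q')%N, (k' + t' = q')%N, (q' * k' <= s)%N &
        (t' * t' + k' <= s)%N].
  have [Z [Zc Zg]] :=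
    very_general_bound R K_char0 K_uncountable q'E q'_gt0 qk' tt'.
  exists Z; split=> // L /Zg; apply: le_trans.
  by rewrite -[q'%:R]/(q'%:Z%:~R) ler_int.
(* For [q <= 0] the bound 1 suffices. Otherwise a negative [k] is raised to 0 and a [k] above [q] is
   lowered to [q], both inequalities being preserved. *)
have [q_le0|q_gt0] := lerP q 0.
  by exists 1%N, 0%N, 1%N; split=> //; lia.
have [k_lt0|k_ge0] := ltrP k 0.
  exists `|q|%N, 0%N, `|q|%N; split=> //; nia.
have [k_le|q_lt] := lerP k q.
  by exists `|q|%N, `|k|%N, `|q - k|%N; split=> //; nia.
by exists `|q|%N, `|q|%N, 0%N; split=> //; nia.
Qed.
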